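(* Let $\kappa\ge 0$ be any constant. In DAGs with $c_{\min}\ge K-\kappa$, where $c_{\min}=\min_{e\in E}c(e)$ and $K$ is the number of terminals (part of the input), CAP-STEINER-TREE is solvable in polynomial time and ML-CAP-STEINER-TREE can be approximated (in polynomial time) within a ratio of $1+\rho$.
   Context: A DAG is a finite directed graph without directed circuits. ML-CAP-STEINER-TREE (directed version). Input: a connected directed graph $G=(V,E)$; a set $T\subset V$ of $K\ge 2$ terminals; a root $r\in V\setminus T$ such that there is a directed path from $r$ to every vertex of $V$; a nonnegative rational length $\ell(e)$ and a positive integer capacity $c(e)$ for every arc $e\in E$. Objective: determine, if one exists, a tree $S$ in $G$, directed away from its root $r$, that spans all vertices of $T$ (it need not span $V$), satisfies the capacity constraints, and has minimum total length. The capacity constraints say: for every arc $e=(u,v)$ of $S$, the subtree of $S$ rooted at $v$ contains at most $c(e)$ terminals. CAP-STEINER-TREE is the special case in which all lengths are $0$, i.e. the decision problem asking whether a feasible tree exists. STEINER-TREE is the special case of ML-CAP-STEINER-TREE in which $c(e)=K$ for all $e\in E$ (i.e. no capacity restriction). $\rho$ denotes the best possible approximation ratio (of a polynomial-time algorithm) for STEINER-TREE in the graph class considered. A polynomial-time algorithm approximates within ratio $\alpha$ if, on every feasible instance, it returns a feasible solution of total length at most $\alpha$ times the minimum. *)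

(* Defs.v *)
From HB Require Import structures.
From mathcomp Require Import all_boot all_order all_algebra.
From mathcomp Require Import reals.

Set Implicit Arguments.
Unset Strict Implicit.
Unset Printing Implicit Defensive.

Import Order.TTheory GRing.Theory Num.Theory.

(** A variable-free form of Jones's WHILE language: programs transform binary
    trees.  Every invocation of a (sub)program costs the size of its argument,
    so the running time bounds the size of every intermediate value
    ([eval_size] below), and the model is polynomially equivalent to Turing
    machines. *)

Inductive tree := Leaf | Node of tree & tree.

Fixpoint tsize (x : tree) : nat :=
  if x is Node y z then (tsize y + tsize z).+1 else 1.

Definition hd (x : tree) : tree := if x is Node y _ then y else Leaf.
Definition tl (x : tree) : tree := if x is Node _ z then z else Leaf.

Inductive prog :=
  | PId | PLeaf | PHd | PTl
  | PPair of prog & prog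
  | PSeq of prog & prog          (* run the first, then the second *)
  | PIf of prog & prog & prog    (* the test holds when it returns a Node *)
  | PWhile of prog & prog.

(* [eval p x t y]: on input x, p halts after time t with output y. *)
Inductive eval : prog -> tree -> nat -> tree -> Prop :=
  | EvId x : eval PId x (tsize x) x
  | EvLeaf x : eval PLeaf x (tsize x) Leaf
  | EvHd x : eval PHd x (tsize x) (hd x)
  | EvTl x : eval PTl x (tsize x) (tl x)
  | EvPair p q x s t y z :
      eval p x s y -> eval q x t z ->
      eval (PPair p q) x (tsize x + s + t) (Node y z)
  | EvSeq p q x s t y z :
      eval p x s y -> eval q y t z -> eval (PSeq p q) x (tsize x + s + t) z
  | EvIfTrue b p q x s t u v y :
      eval b x s (Node u v) -> eval p x t y ->
      eval (PIf b p q) x (tsize x + s + t) y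
  | EvIfFalse b p q x s t y :
      eval b x s Leaf -> eval q x t y ->
      eval (PIf b p q) x (tsize x + s + t) y
  | EvWhileStop b p x s :
      eval b x s Leaf -> eval (PWhile b p) x (tsize x + s) x
  | EvWhileStep b p x s t r u v y z :
      eval b x s (Node u v) -> eval p x t y -> eval (PWhile b p) y r z ->
      eval (PWhile b p) x (tsize x + s + t + r) z.

Lemma tsize_gt0 x : 0 < tsize x.
Proof. by case: x. Qed.

Lemma eval_size p x t y : eval p x t y -> tsize y <= t.
Proof.
elim=> {p x t y} //=.
- by move=> x; rewrite tsize_gt0.
- by case=> //= y z; rewrite leqW ?leq_addr.
- by case=> //= y z; rewrite leqW ?leq_addl.
- move=> p q x s t y z _ ys _ zt.
  by rewrite -addnA -add1n; apply: leq_add (tsize_gt0 x) (leq_add ys zt).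
- by move=> p q x s t y z _ _ _ zt; apply: leq_trans zt (leq_addl _ _).
- by move=> b p q x s t u v y _ _ _ yt; apply: leq_trans yt (leq_addl _ _).
- by move=> b p q x s t y _ _ _ yt; apply: leq_trans yt (leq_addl _ _).
- by move=> b p x s _ _; apply: leq_addr.
- move=> b p x s t r u v y z _ _ _ _ _ zr.
  exact: leq_trans zr (leq_addl _ _).
Qed.

Definition enc_bool (b : bool) : tree := if b then Node Leaf Leaf else Leaf.

Definition enc_seq (A : Type) (enc : A -> tree) (s : seq A) : tree :=
  foldr (fun a x => Node (enc a) x) Leaf s.

(* The binary digits of n, least significant first; [up_log 2 n.+1] is the
   number of significant digits (0 for n = 0). *)
Definition bits (n : nat) : seq bool :=
  mkseq (fun i => odd (n %/ 2 ^ i)) (up_log 2 n.+1).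

Definition enc_nat (n : nat) : tree := enc_seq enc_bool (bits n).

(* Only used for lengths, which are nonnegative: the sign is omitted. *)
Definition enc_rat (q : rat) : tree :=
  Node (enc_nat `|numq q|%N) (enc_nat `|denq q|%N).

(* [len] and [cap] are meaningful on [arcs] only; elsewhere their values are
   arbitrary, unconstrained, and not part of the encoding. *)
Record instance := Instance {
  order : nat;
  arcs : {set 'I_order * 'I_order};
  terminals : {set 'I_order};
  root : 'I_order;
  len : {ffun 'I_order * 'I_order -> rat};
  cap : {ffun 'I_order * 'I_order -> nat}
}.

Definition arc_rel (n : nat) (S : {set 'I_n * 'I_n}) : rel 'I_n :=
  fun u v => (u, v) \in S.

Definition enc_arc (n : nat) (a : 'I_n * 'I_n) : tree :=
  Node (enc_nat a.1) (enc_nat a.2).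

Definition enc_arcs (n : nat) (s : seq ('I_n * 'I_n)) : tree :=
  enc_seq (@enc_arc n) s.

Definition enc_instance (I : instance) : tree :=
  Node (enc_nat (order I))
    (Node (enc_nat (root I))
      (Node (enc_seq (fun v : 'I_(order I) => enc_nat v) (enum (terminals I)))
        (enc_seq
          (fun a => Node (enc_arc a)
                      (Node (enc_rat (len I a)) (enc_nat (cap I a))))
          (enum (arcs I))))).

Definition well_formed (I : instance) : Prop :=
  [/\ forall u v, connect (fun x y => arc_rel (arcs I) x y
                                   || arc_rel (arcs I) y x) u v,
      1 < #|terminals I| /\ root I \notin terminals I,
      forall v, connect (arc_rel (arcs I)) (root I) v,
      forall a, a \in arcs I -> (0 <= len I a)%R
    & forall a, a \in arcs I -> 0 < cap I a].

Definition is_dag (I : instance) : Prop :=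
  forall p : seq 'I_(order I), cycle (arc_rel (arcs I)) p -> p = [::].

(* Minimum of the capacities; the initial value (their maximum) never affects
   the result as soon as there is an arc, which [well_formed] ensures. *)
Definition cmin (I : instance) : nat :=
  \big[minn/(\max_(a in arcs I) cap I a)%N]_(a in arcs I) cap I a.

Definition tree_vertices (n : nat) (r : 'I_n) (S : {set 'I_n * 'I_n}) :
    {set 'I_n} :=
  r |: ([set a.1 | a in S] :|: [set a.2 | a in S]).

Definition tree_away_from (n : nat) (r : 'I_n) (S : {set 'I_n * 'I_n}) : Prop :=
  [/\ forall v, v \in tree_vertices r S -> connect (arc_rel S) r v,
      forall a, a \in S -> a.2 != r
    & forall a b, a \in S -> b \in S -> a.2 = b.2 -> a = b].

Definition subtree (n : nat) (S : {set 'I_n * 'I_n}) (v : 'I_n) : {set 'I_n} :=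
  [set w | connect (arc_rel S) v w].

Definition feasible (I : instance) (S : {set 'I_(order I) * 'I_(order I)}) :
    Prop :=
  [/\ S \subset arcs I,
      tree_away_from (root I) S,
      terminals I \subset tree_vertices (root I) S
    & forall a, a \in S -> #|subtree S a.2 :&: terminals I| <= cap I a].
Arguments feasible : clear implicits.

Definition total_len (I : instance) (S : {set 'I_(order I) * 'I_(order I)}) :
    rat :=
  (\sum_(a in S) len I a)%R.
Arguments total_len : clear implicits.

Definition optimal (I : instance) (S : {set 'I_(order I) * 'I_(order I)}) :
    Prop :=
  feasible I S /\
  forall S', feasible I S' -> (total_len I S <= total_len I S')%R.
Arguments optimal : clear implicits.

Definition zero_len (I : instance) : Prop :=
  forall a, a \in arcs I -> len I a = 0%R.

Definition cap_instance (I : instance) : Prop := well_formed I /\ zero_len I.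

Definition steiner_instance (I : instance) : Prop :=
  well_formed I /\ forall a, a \in arcs I -> cap I a = #|terminals I|.

Definition uncapacitated (I : instance) : instance :=
  Instance (arcs I) (terminals I) (root I) (len I) [ffun=> #|terminals I|].

Definition polytime_on (A : prog) (C : instance -> Prop)
    (ok : instance -> tree -> Prop) : Prop :=
  exists c d : nat, forall I, C I ->
    exists t y, [/\ eval A (enc_instance I) t y,
                    t <= c * tsize (enc_instance I) ^ d
                  & ok I y].

Definition decides_feasibility (I : instance) (y : tree) : Prop :=
  exists2 b : bool, y = enc_bool b & (b <-> exists S, feasible I S).

(* [alpha] may depend on the instance.  The output lists the arcs of the tree
   in any order; on infeasible instances it is unconstrained. *)
Definition approximates (R : realType) (alpha : instance -> R)
    (I : instance) (y : tree) : Prop :=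
  (exists S, feasible I S) ->
  exists s : seq ('I_(order I) * 'I_(order I)),
    [/\ y = enc_arcs s,
        feasible I [set a in s]
      & forall Sopt, optimal I Sopt ->
          (ratr (total_len I [set a in s])
             <= alpha I * ratr (total_len I Sopt))%R].

Definition solvable_in_polytime (C : instance -> Prop) : Prop :=
  exists A, polytime_on A C decides_feasibility.

Definition approximable_within (R : realType) (C : instance -> Prop)
    (alpha : instance -> R) : Prop :=
  exists A, polytime_on A C (approximates alpha).

Definition large_cmin (R : realType) (kappa : R) (I : instance) : Prop :=
  (#|terminals I|%:R - kappa <= (cmin I)%:R)%R.

(* Main.v *)
(** Let [k] bound [kappa], so that every capacity is at least [K - k].

    A skeleton is a set [A] of [M = min (2k, K)] terminals together with a tree
    [S] containing [A] in which every arc [a] leaves at least [K - c(a)]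
    elements of [A] outside its subtree.  Every feasible tree is a skeleton for
    a suitable [A], because its subtrees form a laminar family: adding [k] times
    two terminals separated by the subtrees that still miss a terminal gives
    [|A \ F| >= min (k, |T \ F|)] for each subtree [F].  Conversely, a skeleton
    [S] and any Steiner tree [S'] combine into a feasible tree of length at most
    [len S + len S'], which keeps [S] and adds the arcs of [S'] that enter no
    vertex of [S].  Hence an optimal skeleton and a [rho]-approximate Steiner
    tree give the ratio [1 + rho], and feasibility amounts to the existence of a
    skeleton.

    As the number of terminals in [A] is bounded, an optimal skeleton is found
    by moving [M] tokens from the root: the vertices [w] are scanned in
    topological order, and some of the tokens standing on one predecessor of
    [w] may jump to [w] together.  For each of the polynomially many token
    positions, only a cheapest set of traversed arcs is kept. *)

Require Import Defs.
From HB Require Import structures.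
From mathcomp Require Import all_boot all_order all_algebra.
From mathcomp Require Import reals.
From mathcomp Require Import zify.
(* MathComp also defines [order], [root] and [tsize]. *)
Import Defs.

Set Implicit Arguments.
Unset Strict Implicit.
Unset Printing Implicit Defensive.

Import Order.TTheory GRing.Theory Num.Theory.
Local Open Scope nat_scope.

(** * Polynomial-time functions between encoded types *)

(** The bound [min (k, |T \ F|)] fits the capacities: if at least [k] elements of [A] avoid [F],
    then [c >= K - k] is enough; otherwise [A] contains every terminal that avoids [F], and the
    constraint of the feasible tree itself applies. A round takes two terminals because a single one
    may lie in [F], which then gains nothing. A capacity can be checked at the moment of a jump
    because the order is topological: each vertex is entered at most once, so the tokens on [w] just
    after the jump are those that end below [w]. The obstacle is that time is measured on a program
    over encoded numerals, while correctness concerns finite sets of ordinals. The dynamic program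
    is therefore written over abstract vertices, arcs and cost comparison, timed on numerals, proved
    correct on ordinals, and the two runs are matched by invariance under renaming. *)

Class Enc (T : Type) := enc : T -> tree.
#[global] Instance enc_tree_inst : Enc tree := id.
#[global] Instance enc_bool_inst : Enc bool := enc_bool.
#[global] Instance enc_nat_inst : Enc nat := enc_nat.
#[global] Instance enc_pair_inst T U `{Enc T} `{Enc U} : Enc (T * U) :=
  fun p => Node (enc p.1) (enc p.2).
#[global] Instance enc_seq_inst T `{Enc T} : Enc (seq T) := enc_seq enc.

Definition sz T `{Enc T} (x : T) := tsize (enc x).

Lemma sz_gt0 T `{Enc T} (x : T) : 0 < sz x.
Proof. exact: tsize_gt0. Qed.

Lemma sz_pair T U `{Enc T} `{Enc U} (p : T * U) : sz p = (sz p.1 + sz p.2).+1.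
Proof. by []. Qed.

Lemma sz_nil T `{Enc T} : sz (@nil T) = 1. Proof. by []. Qed.

Lemma sz_cons T `{Enc T} a (s : seq T) : sz (a :: s) = (sz a + sz s).+1.
Proof. by []. Qed.

Section PolynomialBounds.
Context (X : Type) `{Enc X}.
Implicit Types f g : X -> nat.

Definition pbounded f := exists c d, forall x, f x <= c * sz x ^ d.

Lemma pb_le f g : (forall x, f x <= g x) -> pbounded g -> pbounded f.
Proof. by move=> fg [c [d gd]]; exists c, d => x; apply: leq_trans (fg x) (gd x). Qed.

Lemma pb_cst n : pbounded (fun=> n).
Proof. by exists n, 0 => x; rewrite expn0 muln1. Qed.

Lemma pb_sz : pbounded (@sz X _).
Proof. by exists 1, 1 => x; rewrite mul1n expn1. Qed.

Lemma pb_add f g : pbounded f -> pbounded g -> pbounded (fun x => f x + g x).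
Proof.
move=> [c [d fd]] [c' [d' gd]]; exists (c + c'), (d + d') => x.
rewrite mulnDl; apply: leq_add; first apply: leq_trans (fd x) _.
  by rewrite leq_mul2l leq_pexp2l ?orbT ?sz_gt0 ?leq_addr.
apply: leq_trans (gd x) _.
by rewrite leq_mul2l leq_pexp2l ?orbT ?sz_gt0 ?leq_addl.
Qed.

Lemma pb_mul f g : pbounded f -> pbounded g -> pbounded (fun x => f x * g x).
Proof.
move=> [c [d fd]] [c' [d' gd]]; exists (c * c'), (d + d') => x.
by rewrite expnD mulnACA leq_mul.
Qed.

Lemma pb_S f : pbounded f -> pbounded (fun x => (f x).+1).
Proof.
move=> pf; apply: (@pb_le _ (fun x => f x + 1)); first by move=> x; rewrite addn1.
exact: pb_add pf (pb_cst 1).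
Qed.

Lemma pb_exp f d : pbounded f -> pbounded (fun x => f x ^ d).
Proof.
move=> pf; elim: d => [|d IH].
  by apply: (@pb_le _ (fun=> 1)) => [x|]; rewrite ?expn0 //; apply: pb_cst.
apply: (@pb_le _ (fun x => f x * f x ^ d)); last exact: pb_mul.
by move=> x; rewrite expnS.
Qed.

End PolynomialBounds.

Lemma pb_comp X Y `{Enc X} `{Enc Y} (f : X -> Y) (g : Y -> nat) :
  pbounded (fun x => sz (f x)) -> pbounded g -> pbounded (fun x => g (f x)).
Proof.
move=> pf [c [d gd]]; apply: pb_le (pb_mul (pb_cst c) (pb_exp d pf)) => x.
exact: gd.
Qed.

Ltac pb := repeat (cbv beta; first [ assumption | lazymatch goal with
  | |- pbounded (fun _ => ?n) => exact: pb_cst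
  | |- pbounded (fun x => sz x) => exact: pb_sz
  | |- pbounded sz => exact: pb_sz
  | |- pbounded (fun x => (@?f x).+1) => apply: (@pb_S _ _ f)
  | |- pbounded (fun x => @?f x + @?g x) => apply: (@pb_add _ _ f g)
  | |- pbounded (fun x => @?f x * @?g x) => apply: (@pb_mul _ _ f g)
  | |- pbounded (fun x => @?f x ^ ?d) => apply: (@pb_exp _ _ f d)
  end ]).

(** The bound [tm] is a function of the input itself, so bounds compose without any monotonicity in
    the size. *)
Definition ptime X Y `{Enc X} `{Enc Y} (f : X -> Y) : Prop :=
  exists p : prog, exists2 tm : X -> nat, pbounded tm &
    forall x, exists2 t, eval p (enc x) t (enc (f x)) & t <= tm x.

(** The running time bounds the size of the output; this is what keeps compositions polynomial. *)
Lemma ptime_size X Y `{Enc X} `{Enc Y} (f : X -> Y) :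
  ptime f -> pbounded (fun x => sz (f x)).
Proof.
move=> [p [tm ptm ev]]; apply: pb_le ptm => x.
by have [t /eval_size xt tle] := ev x; apply: leq_trans xt tle.
Qed.

Lemma ptime_ext X Y `{Enc X} `{Enc Y} (f g : X -> Y) :
  f =1 g -> ptime f -> ptime g.
Proof.
move=> fg [p [tm ptm ev]]; exists p; exists tm => // x.
by rewrite -fg.
Qed.

(** Covers changes of type that leave the encoding alone, such as reading a pair of a head and a
    tail as a list. *)
Lemma ptime_recode X Y `{Enc X} `{Enc Y} (f : X -> Y) :
  (forall x, enc (f x) = enc x) -> ptime f.
Proof.
move=> fE; exists PId; exists (@sz X _); first exact: pb_sz.
by move=> x; exists (sz x) => //; rewrite fE; apply: EvId.
Qed.

Lemma pt_id X `{Enc X} : ptime (fun x : X => x).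
Proof. exact: ptime_recode. Qed.

Lemma pt_comp X Y Z `{Enc X} `{Enc Y} `{Enc Z} (f : X -> Y) (g : Y -> Z) :
  ptime g -> ptime f -> ptime (fun x => g (f x)).
Proof.
move=> [q [tg ptg evg]] ptf; have szf := ptime_size ptf.
case: ptf => p [tf ptf evf]; exists (PSeq p q).
exists (fun x => sz x + tf x + tg (f x)).
  by pb; apply: (pb_comp szf).
move=> x; have [t ev le] := evf x; have [t' ev' le'] := evg (f x).
exists (sz x + t + t'); first exact: EvSeq ev ev'.
by rewrite leq_add ?leq_add2l.
Qed.

Lemma pt_pair X Y Z `{Enc X} `{Enc Y} `{Enc Z} (f : X -> Y) (g : X -> Z) :
  ptime f -> ptime g -> ptime (fun x => (f x, g x)).
Proof.
move=> [p [tf ptf evf]] [q [tg ptg evg]]; exists (PPair p q).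
exists (fun x => sz x + tf x + tg x); first by pb.
move=> x; have [t ev le] := evf x; have [t' ev' le'] := evg x.
exists (sz x + t + t'); first exact: EvPair ev ev'.
by rewrite leq_add ?leq_add2l.
Qed.

Lemma pt_cst X Y `{Enc X} `{Enc Y} (y : Y) : ptime (fun _ : X => y).
Proof.
(* The program writes the encoding of [y] node by node, so the induction is on that tree. *)
have: ptime (fun _ : X => enc y); last first.
  by move=> [p [tm ptm ev]]; exists p; exists tm.
elim: (enc y) => [|u [p [tu ptu evu]] v [q [tv ptv evv]]].
  exists PLeaf; exists (@sz X _); first exact: pb_sz.
  by move=> x; exists (sz x) => //; apply: EvLeaf.
exists (PPair p q); exists (fun x => sz x + tu x + tv x); first by pb.
move=> x; have [t ev le] := evu x; have [t' ev' le'] := evv x.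
exists (sz x + t + t'); first exact: EvPair ev ev'.
by rewrite leq_add ?leq_add2l.
Qed.

Lemma pt_of_hd X Y `{Enc X} `{Enc Y} (f : X -> Y) :
  (forall x, enc (f x) = hd (enc x)) -> ptime f.
Proof.
move=> fE; exists PHd; exists (@sz X _); first exact: pb_sz.
by move=> x; exists (sz x) => //; rewrite fE; apply: EvHd.
Qed.

Lemma pt_of_tl X Y `{Enc X} `{Enc Y} (f : X -> Y) :
  (forall x, enc (f x) = tl (enc x)) -> ptime f.
Proof.
move=> fE; exists PTl; exists (@sz X _); first exact: pb_sz.
by move=> x; exists (sz x) => //; rewrite fE; apply: EvTl.
Qed.

Lemma pt_fst X Y Z `{Enc X} `{Enc Y} `{Enc Z} (f : X -> Y * Z) :
  ptime f -> ptime (fun x => (f x).1).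
Proof. by apply: pt_comp; apply: pt_of_hd. Qed.

Lemma pt_snd X Y Z `{Enc X} `{Enc Y} `{Enc Z} (f : X -> Y * Z) :
  ptime f -> ptime (fun x => (f x).2).
Proof. by apply: pt_comp; apply: pt_of_tl. Qed.

Lemma pt_cons X Y `{Enc X} `{Enc Y} (f : X -> Y) (g : X -> seq Y) :
  ptime f -> ptime g -> ptime (fun x => f x :: g x).
Proof.
move=> pf pg; have := @pt_comp _ _ (seq Y) _ _ _ _ (fun p => p.1 :: p.2) _ (pt_pair pf pg).
by apply; apply: ptime_recode.
Qed.

Lemma pt_behead X Y `{Enc X} `{Enc Y} (f : X -> seq Y) :
  ptime f -> ptime (fun x => behead (f x)).
Proof. by apply: pt_comp; apply: pt_of_tl => -[]. Qed.

(** Only the shape of [enc (b x)] is tested, whatever the type of [b x]; this serves booleans and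
    emptiness of lists alike. *)
Lemma pt_if_enc X Y `{Enc X} `{Enc Y} B `{Enc B} (b : X -> B) (c : X -> bool)
    (f g : X -> Y) :
  (forall x, c x = if enc (b x) is Node _ _ then true else false) ->
  ptime b -> ptime f -> ptime g -> ptime (fun x => if c x then f x else g x).
Proof.
move=> cE [p [tb ptb evb]] [q [tf ptf evf]] [r [tg ptg evg]].
exists (PIf p q r); exists (fun x => sz x + tb x + (tf x + tg x)); first by pb.
move=> x; have [t ev le] := evb x; rewrite cE.
case ebx: (enc (b x)) ev => [|u v] ev.
  have [t' ev' le'] := evg x; exists (sz x + t + t'); first exact: EvIfFalse ev ev'.
  by rewrite leq_add ?leq_add2l // (leq_trans le') ?leq_addl.
have [t' ev' le'] := evf x; exists (sz x + t + t'); first exact: EvIfTrue ev ev'.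
by rewrite leq_add ?leq_add2l // (leq_trans le') ?leq_addr.
Qed.

Lemma pt_if X Y `{Enc X} `{Enc Y} (c : X -> bool) (f g : X -> Y) :
  ptime c -> ptime f -> ptime g -> ptime (fun x => if c x then f x else g x).
Proof. by apply: pt_if_enc => x; case: (c x). Qed.

Lemma pt_nilp X Y `{Enc X} `{Enc Y} (f : X -> seq Y) :
  ptime f -> ptime (fun x => nilp (f x)).
Proof.
move=> pf; apply: (@ptime_ext _ _ _ _ (fun x => if ~~ nilp (f x) then false else true)).
  by move=> x; case: nilp.
apply: (pt_if_enc (b := f)) => //; try exact: pt_cst.
by move=> x; case: (f x).
Qed.

Lemma pt_head X Y `{Enc X} `{Enc Y} (y : Y) (f : X -> seq Y) :
  ptime f -> ptime (fun x => head y (f x)).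
Proof.
apply: pt_comp => //; have [p [tm ptm ev]] := @pt_cst (seq Y) Y _ _ y.
exists (PIf PId PHd p); exists (fun s => sz s + sz s + (sz s + tm s)); first by pb.
case=> [|a s].
  have [t ev' le] := ev [::]; exists (sz (@nil Y) + sz (@nil Y) + t).
    exact: EvIfFalse (EvId _) ev'.
  by rewrite leq_add2l (leq_trans le) ?leq_addl.
exists (sz (a :: s) + sz (a :: s) + sz (a :: s)).
  by apply: (@EvIfTrue PId PHd p (enc (a :: s)) _ _ (enc a) (enc s)); [apply: EvId | apply: EvHd].
by rewrite leq_add2l leq_addr.
Qed.

(** The [while] loop keeps the triple (environment, remaining list, state). *)
Section Fold.
Context (X A S : Type) `{Enc X} `{Enc A} `{Enc S}.
Variables (l : X -> seq A) (s0 : X -> S) (step : X -> S -> A -> S).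

(** A polynomial-time step could double the state at every iteration, so its size has to be
    controlled after every prefix of the list. *)
Definition fold_bounded := exists c d, forall x l1 l2, l x = l1 ++ l2 ->
  sz (foldl (step x) (s0 x) l1) <= c * sz x ^ d.

Let pelem := PSeq (PSeq PTl PHd) PHd.
Let body q := PPair PHd (PPair (PSeq (PSeq PTl PHd) PTl)
                (PSeq (PPair (PPair PHd (PSeq PTl PTl)) pelem) q)).

Lemma fold_body q (x : X) a (l2 : seq A) (s : S) t (z : S) :
  eval q (enc (x, s, a)) t (enc z) ->
  exists2 t', eval (body q) (Node (enc x) (Node (enc (a :: l2)) (enc s))) t'
                (Node (enc x) (Node (enc l2) (enc z))) &
    t' <= 40 * (sz x + sz (a :: l2) + sz s + 2) + t.
Proof.
move=> ev; eexists.
  apply: EvPair; first exact: EvHd.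
  apply: EvPair; first by apply: EvSeq (EvSeq (EvTl _) (EvHd _)) (EvTl _).
  apply: EvSeq; last exact: ev.
  apply: EvPair; last exact: EvSeq (EvSeq (EvTl _) (EvHd _)) (EvHd _).
  by apply: EvPair (EvHd _) (EvSeq (EvTl _) (EvTl _)).
by rewrite /= /sz /=; lia.
Qed.

(** [N] bounds the loop state and [T] the time of one step. The factor 50 leaves ample room for the
    projections and pairings of an iteration, each of which costs the size of its argument. *)
Lemma fold_loop q x N T l1 l2 : l x = l1 ++ l2 ->
  (forall l1 l2, l x = l1 ++ l2 ->
     sz x + sz l2 + sz (foldl (step x) (s0 x) l1) + 2 <= N) ->
  (forall l1 a l2, l x = l1 ++ a :: l2 ->
     let s := foldl (step x) (s0 x) l1 in
     exists2 t, eval q (enc (x, s, a)) t (enc (step x s a)) & t <= T) ->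
  exists2 t, eval (PWhile (PSeq PTl PHd) (body q))
      (Node (enc x) (Node (enc l2) (enc (foldl (step x) (s0 x) l1)))) t
      (Node (enc x) (Node Leaf (enc (foldl (step x) (s0 x) (l x))))) &
    t <= (size l2).+1 * (50 * N + T).
Proof.
move=> + szN evT; elim: l2 l1 => [|a l2 IH] l1 lE.
  have := szN _ _ lE; rewrite lE cats0 mul1n; set s := foldl _ _ _ => sN.
  eexists; first by apply: EvWhileStop; apply: EvSeq (EvTl _) (EvHd _).
  by move: sN; rewrite /= /sz /=; lia.
have := szN _ _ lE; have [t ev tT] := evT _ _ _ lE.
have [t1 ev1 t1le] := fold_body l2 ev.
have [|t2 ev2 t2le] := IH (rcons l1 a); first by rewrite cat_rcons.
move: ev2; rewrite -cats1 foldl_cat /= => ev2 sN.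
eexists.
  apply: EvWhileStep ev1 ev2; exact: EvSeq (EvTl _) (EvHd _).
by move: sN t1le; rewrite /= /sz /=; lia.
Qed.

Lemma pt_foldl : ptime l -> ptime s0 ->
  ptime (fun p : X * S * A => step p.1.1 p.1.2 p.2) -> fold_bounded ->
  ptime (fun x => foldl (step x) (s0 x) (l x)).
Proof.
move=> ptl pts [q [tq [c [d ptq]] evq]] [c0 [d0 bnd]].
have szl := ptime_size ptl; have szs := ptime_size pts.
case: ptl => pl [tl ptl evl]; case: pts => ps [ts pts evs].
exists (PSeq (PPair PId (PPair pl ps))
         (PSeq (PWhile (PSeq PTl PHd) (body q)) (PSeq PTl PTl))).
pose (N := fun x => sz x + sz (l x) + c0 * sz x ^ d0 + 2).
pose (T := fun x => c * N x ^ d).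
exists (fun x => 10 * (sz x + sz (l x) + sz (s0 x) + tl x + ts x + N x + 3) +
                 sz (l x) * (50 * N x + T x)).
  by rewrite /T /N; pb.
move=> x; have szN l1 l2 : l x = l1 ++ l2 ->
    sz x + sz l2 + sz (foldl (step x) (s0 x) l1) + 2 <= N x.
  move=> lE; have := bnd _ _ _ lE; rewrite /N lE.
  have: sz l2 <= sz (l1 ++ l2).
    by elim: (l1) => [|a l1' IH] //; rewrite cat_cons sz_cons; have := sz_gt0 a; lia.
  by lia.
have evT l1 a l2 : l x = l1 ++ a :: l2 -> let s := foldl (step x) (s0 x) l1 in
    exists2 t, eval q (enc (x, s, a)) t (enc (step x s a)) & t <= T x.
  move=> lE s; have [t ev tle] := evq (x, s, a); exists t => //.
  apply: leq_trans tle (leq_trans (ptq _) _).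
  rewrite /T leq_mul2l; apply/orP; right.
  have: sz (x, s, a) <= N x.
    by have := szN _ _ lE; rewrite -/s !sz_pair sz_cons /=; lia.
  by case: (d) => // d'; rewrite leq_exp2r.
have [t ev tle] := @fold_loop q x (N x) (T x) [::] (l x) erefl szN evT.
have [t1 ev1 le1] := evl x; have [t2 ev2 le2] := evs x.
eexists.
  apply: EvSeq; first by apply: EvPair (EvId _) (EvPair ev1 ev2).
  by apply: EvSeq ev _; apply: EvSeq (EvTl _) (EvTl _).
have := szN _ _ (esym (cats0 (l x))).
have szlx : (size (l x)).+1 <= sz (l x).
  by elim: (l x) => //= a l' IH; rewrite sz_cons; have := sz_gt0 a; lia.
have tle' := leq_trans tle (leq_mul szlx (leqnn _)).
by rewrite /= /sz /= in tle' *; lia.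
Qed.

End Fold.

(** * Lists *)

Lemma ptime_eq_enc X Y Z `{Enc X} `{Enc Y} `{Enc Z} (f : X -> Y) (g : X -> Z) :
  (forall x, enc (f x) = enc (g x)) -> ptime f -> ptime g.
Proof.
move=> fg [p [tm ptm ev]]; exists p; exists tm => // x.
by rewrite -fg.
Qed.

Lemma size_sz A `{Enc A} (s : seq A) : size s < sz s.
Proof. by elim: s => //= a s IH; rewrite sz_cons; have := sz_gt0 a; lia. Qed.

Lemma sz_behead A `{Enc A} (s : seq A) : sz (behead s) <= sz s.
Proof. by case: s => //= a s; rewrite sz_cons; lia. Qed.

Lemma sz_cat A `{Enc A} (s1 s2 : seq A) : sz (s1 ++ s2) < sz s1 + sz s2.
Proof. by elim: s1 => //= a s IH; rewrite !sz_cons; lia. Qed.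

Lemma sz_mem (A : eqType) `{Enc A} (s : seq A) a : a \in s -> sz a < sz s.
Proof.
elim: s => // b s IH; rewrite inE sz_cons; case/predU1P => [->|/IH]; last by lia.
by have := sz_gt0 s; lia.
Qed.

Lemma sz_bool (b : bool) : sz b <= 3. Proof. by case: b. Qed.

(** The growth depends on the environment and the element, never on the state, so the increments add
    up instead of compounding. *)
Lemma fold_bounded_add X A S `{Enc X} `{Enc A} `{Enc S} (l : X -> seq A)
    (s0 : X -> S) (step : X -> S -> A -> S) (g : X * A -> nat) :
  ptime l -> ptime s0 -> pbounded g ->
  (forall x s a, sz (step x s a) <= sz s + g (x, a)) ->
  fold_bounded l s0 step.
Proof.
move=> /ptime_size szl /ptime_size szs [c [d gd]] grow.
have [c' [d' bnd]]: pbounded (fun x =>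
    sz (s0 x) + sz (l x) * (c * (sz x + sz (l x) + 1) ^ d)) by pb.
exists c', d' => x l1 l2 lE; apply: leq_trans (bnd x); rewrite lE.
have: sz (foldl (step x) (s0 x) l1) <=
    sz (s0 x) + size l1 * (c * (sz x + sz (l1 ++ l2) + 1) ^ d); last first.
  move=> /leq_trans; apply; rewrite leq_add2l leq_mul2r; apply/orP; right.
  by apply: leq_trans (ltnW (size_sz _)); rewrite size_cat leq_addr.
elim: l1 (s0 x) l2 {lE} => [|a l1 IH] s l2 /=; first by rewrite addn0.
apply: leq_trans (IH _ (a :: l2)) _; rewrite mulSn addnA.
have szE : sz (l1 ++ a :: l2) = sz (a :: (l1 ++ l2)).
  elim: {IH} l1 => //= b l1 IH; rewrite sz_cons IH !sz_cons; lia.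
rewrite szE leq_add2r; apply: leq_trans (grow _ _ _) _.
rewrite leq_add2l; apply: leq_trans (gd _) _; rewrite leq_mul2l; apply/orP; right.
have: sz (x, a) <= sz x + sz (a :: l1 ++ l2) + 1.
  by rewrite sz_pair sz_cons /=; lia.
by case: (d) => // d'' ?; rewrite leq_exp2r.
Qed.

Lemma pt_foldl_add X A S `{Enc X} `{Enc A} `{Enc S} (l : X -> seq A)
    (s0 : X -> S) (step : X -> S -> A -> S) (g : X * A -> nat) :
  pbounded g ->
  (forall x s a, sz (step x s a) <= sz s + g (x, a)) ->
  ptime l -> ptime s0 ->
  ptime (fun p : X * S * A => step p.1.1 p.1.2 p.2) ->
  ptime (fun x => foldl (step x) (s0 x) (l x)).
Proof. by move=> pg grow pl ps pstep; apply: pt_foldl => //; apply: fold_bounded_add pg grow. Qed.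

Lemma pt_env2 X A S B `{Enc X} `{Enc A} `{Enc S} `{Enc B} (F : X -> A -> B) :
  ptime (fun p : X * A => F p.1 p.2) ->
  ptime (fun p : X * S * A => F p.1.1 p.2).
Proof.
move=> pF; apply: (pt_comp (f := fun p : X * S * A => (p.1.1, p.2)) pF).
apply: pt_pair; last exact: pt_snd pt_id.
exact: pt_fst (pt_fst pt_id).
Qed.

Section Booleans.
Context (X : Type) `{Enc X}.
Implicit Types b c : X -> bool.

Lemma pt_andb b c :
  ptime b -> ptime c -> ptime (fun x => b x && c x).
Proof. by move=> pb pc; apply: pt_if => //; apply: pt_cst. Qed.

Lemma pt_negb b : ptime b -> ptime (fun x => ~~ b x).
Proof. by move=> pb; apply: pt_if => //; apply: pt_cst. Qed.

Lemma pt_orb b c :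
  ptime b -> ptime c -> ptime (fun x => b x || c x).
Proof. by move=> pb pc; apply: pt_if => //; apply: pt_cst. Qed.

Lemma pt_implyb b c :
  ptime b -> ptime c -> ptime (fun x => b x ==> c x).
Proof. by move=> pb pc; apply: pt_if => //; apply: pt_cst. Qed.

Lemma pt_eqb b c :
  ptime b -> ptime c -> ptime (fun x => b x == c x).
Proof.
move=> pb pc; apply: (@ptime_ext _ _ _ _ (fun x => if b x then c x else ~~ c x)).
  by move=> x; case: (b x); case: (c x).
exact: pt_if pb pc (pt_negb pc).
Qed.

Lemma pt_addb b c :
  ptime b -> ptime c -> ptime (fun x => b x (+) c x).
Proof.
move=> pb pc; apply: (@ptime_ext _ _ _ _ (fun x => if b x then ~~ c x else c x)).
  by move=> x; case: (b x); case: (c x).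
exact: pt_if pb (pt_negb pc) pc.
Qed.

End Booleans.

Section Lists.
Context (X A B : Type) `{Enc X} `{Enc A} `{Enc B}.
Implicit Types (l : X -> seq A) (c : X -> bool).

Lemma pt_rev l : ptime l -> ptime (fun x => rev (l x)).
Proof.
move=> pl; apply: (@ptime_ext _ _ _ _ (fun x => foldl (fun s a => a :: s) [::] (l x))).
  move=> x; rewrite /rev; elim: (l x) [::] => //= a s IH s'; exact: IH.
apply: (@pt_foldl_add _ _ _ _ _ _ _ _ _ (fun p => (sz p.2).+1)) => //.
- by apply: pb_S; apply: ptime_size (pt_snd pt_id).
- by move=> x s a; rewrite sz_cons /=; lia.
- exact: pt_cst.
- by apply: pt_cons; [apply: pt_snd pt_id | apply: pt_snd (pt_fst pt_id)].
Qed.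

(** A left fold that conses reverses its list, hence the preliminary [rev] here and in the
    comprehensions below. *)
Lemma pt_cat (l1 l2 : X -> seq A) :
  ptime l1 -> ptime l2 -> ptime (fun x => l1 x ++ l2 x).
Proof.
move=> pl1 pl2; apply: (@ptime_ext _ _ _ _ (fun x => foldl (fun s a => a :: s) (l2 x) (rev (l1 x)))).
  by move=> x; rewrite foldl_rev; elim: (l1 x) => //= a s ->.
apply: (@pt_foldl_add _ _ _ _ _ _ _ _ _ (fun p => (sz p.2).+1)) => //.
- by apply: pb_S; apply: ptime_size (pt_snd pt_id).
- by move=> x s a; rewrite sz_cons /=; lia.
- exact: pt_rev.
- by apply: pt_cons; [apply: pt_snd pt_id | apply: pt_snd (pt_fst pt_id)].
Qed.

End Lists.

Section Comprehensions.
Context (X A B : Type) `{Enc X} `{Enc A} `{Enc B}.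
Implicit Types (l : X -> seq A) (c : X -> bool).

Lemma pt_map l (F : X -> A -> B) :
  ptime l -> ptime (fun p : X * A => F p.1 p.2) ->
  ptime (fun x => map (F x) (l x)).
Proof.
move=> pl pF.
apply: (@ptime_ext _ _ _ _ (fun x => foldl (fun s a => F x a :: s) [::] (rev (l x)))).
  by move=> x; rewrite foldl_rev; elim: (l x) => //= a s ->.
apply: (@pt_foldl_add _ _ _ _ _ _ _ _ _ (fun p => (sz (F p.1 p.2)).+1)) => //.
- by apply: pb_S; apply: ptime_size pF.
- by move=> x s a; rewrite sz_cons /=; lia.
- exact: pt_rev.
- exact: pt_cst.
- by apply: pt_cons; [apply: pt_env2 | apply: pt_snd (pt_fst pt_id)].
Qed.

Lemma pt_filter l (F : X -> A -> bool) :
  ptime l -> ptime (fun p : X * A => F p.1 p.2) ->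
  ptime (fun x => filter (F x) (l x)).
Proof.
move=> pl pF.
apply: (@ptime_ext _ _ _ _ (fun x => foldl (fun s a => if F x a then a :: s else s) [::] (rev (l x)))).
  move=> x; rewrite foldl_rev.
  by elim: (l x) => //= a s ->.
apply: (@pt_foldl_add _ _ _ _ _ _ _ _ _ (fun p => (sz p.2).+1)) => //.
- by apply: pb_S; apply: ptime_size (pt_snd pt_id).
- by move=> x s a; case: ifP; rewrite ?sz_cons /=; lia.
- exact: pt_rev.
- exact: pt_cst.
- apply: pt_if; [exact: pt_env2 | | exact: pt_snd (pt_fst pt_id)].
  by apply: pt_cons; [apply: pt_snd pt_id | apply: pt_snd (pt_fst pt_id)].
Qed.

Lemma pt_flatten (l : X -> seq (seq A)) :
  ptime l -> ptime (fun x => flatten (l x)).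
Proof.
move=> pl; apply: (@ptime_ext _ _ _ _ (fun x => foldl (fun s a => a ++ s) [::] (rev (l x)))).
  by move=> x; rewrite foldl_rev.
apply: (@pt_foldl_add _ _ _ _ _ _ _ _ _ (fun p => (sz p.2).+1)) => //.
- by apply: pb_S; apply: ptime_size (pt_snd pt_id).
- by move=> x s a; apply: leq_trans (ltnW (sz_cat a s)) _; rewrite /=; lia.
- exact: pt_rev.
- exact: pt_cst.
- by apply: pt_cat; [apply: pt_snd pt_id | apply: pt_snd (pt_fst pt_id)].
Qed.

End Comprehensions.

Section Quantifiers.
Context (X A : Type) `{Enc X} `{Enc A}.
Implicit Types (l : X -> seq A).

Lemma pt_all l (F : X -> A -> bool) :
  ptime l -> ptime (fun p : X * A => F p.1 p.2) ->
  ptime (fun x => all (F x) (l x)).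
Proof.
move=> pl pF.
apply: (@ptime_ext _ _ _ _ (fun x => nilp (filter (fun a => ~~ F x a) (l x)))).
  move=> x; rewrite /nilp size_filter; elim: (l x) => //= a s <-.
  by case: (F x a).
by apply: pt_nilp; apply: pt_filter => //; apply: pt_negb.
Qed.

Lemma pt_has l (F : X -> A -> bool) :
  ptime l -> ptime (fun p : X * A => F p.1 p.2) ->
  ptime (fun x => has (F x) (l x)).
Proof.
move=> pl pF.
apply: (@ptime_ext _ _ _ _ (fun x => ~~ nilp (filter (F x) (l x)))).
  by move=> x; rewrite /nilp size_filter has_count -lt0n.
by apply: pt_negb; apply: pt_nilp; apply: pt_filter.
Qed.

End Quantifiers.

(** * Automation of polynomial-time proofs, extended to arithmetic through [pt_hook] *)

Ltac pt_hook := fail.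
Ltac pt1 := cbv beta; lazymatch goal with
  | |- ptime (fun _ => ?y) => exact: pt_cst
  | |- ptime (fun x => x) => exact: pt_id
  | |- ptime (fun x => fst (@?f x)) => apply: (@pt_fst _ _ _ _ _ _ f)
  | |- ptime (fun x => snd (@?f x)) => apply: (@pt_snd _ _ _ _ _ _ f)
  | |- ptime (fun x => pair _ _) => apply: pt_pair
  | |- ptime (fun x => cons _ _) => apply: pt_cons
  | |- ptime (fun x => behead (@?f x)) => apply: (@pt_behead _ _ _ _ f)
  | |- ptime (fun x => nilp (@?f x)) => apply: (@pt_nilp _ _ _ _ f)
  | |- ptime (fun x => head ?y (@?f x)) => apply: (@pt_head _ _ _ _ y f)
  | |- ptime (fun x => rev (@?f x)) => apply: (@pt_rev _ _ _ _ f)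
  | |- ptime (fun x => cat (@?f x) (@?g x)) => apply: (@pt_cat _ _ _ _ f g)
  | |- ptime (fun x => filter (@?F x) (@?f x)) => apply: (@pt_filter _ _ _ _ f F)
  | |- ptime (fun x => map (@?F x) (@?f x)) => apply: (@pt_map _ _ _ _ _ _ f F)
  | |- ptime (fun x => flatten (@?f x)) => apply: (@pt_flatten _ _ _ _ f)
  | |- ptime (fun x => all (@?F x) (@?f x)) => apply: (@pt_all _ _ _ _ f F)
  | |- ptime (fun x => has (@?F x) (@?f x)) => apply: (@pt_has _ _ _ _ f F)
  | |- ptime (fun x => andb (@?f x) (@?g x)) => apply: (@pt_andb _ _ f g)
  | |- ptime (fun x => orb (@?f x) (@?g x)) => apply: (@pt_orb _ _ f g)
  | |- ptime (fun x => implb (@?f x) (@?g x)) => apply: (@pt_implyb _ _ f g)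
  | |- ptime (fun x => negb (@?f x)) => apply: (@pt_negb _ _ f)
  | |- ptime (fun x => addb (@?f x) (@?g x)) => apply: (@pt_addb _ _ f g)
  | |- ptime (fun x => @eq_op _ (@?f x) (@?g x)) => first [ apply: (@pt_eqb _ _ f g) | pt_hook ]
  | |- ptime fst => exact: (pt_fst pt_id)
  | |- ptime snd => exact: (pt_snd pt_id)
  | |- _ => pt_hook
  end.
Ltac pt_env := match goal with
  | f_pt : ptime ?f |- ptime (fun x => ?f (@?g x)) => apply: (@pt_comp _ _ _ _ _ _ g f f_pt)
  end.
Ltac pt := repeat first [ assumption | pt_env | pt1 ].

(** * Binary arithmetic *)

(** Positivity excludes a leading zero, as [bits 0] is empty. *)
Lemma bits_cons (b : bool) n : (0 < b + n.*2) -> bits (b + n.*2) = b :: bits n.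
Proof.
move=> gt0; rewrite /bits /mkseq.
rewrite up_log2S // half_bit_double.
rewrite /= expn0 divn1 oddD odd_double addbF oddb; congr (_ :: _).
rewrite -[1]addn0 iotaDl -map_comp; apply: eq_map => i /=.
by rewrite expnS divnMA divn2 half_bit_double.
Qed.

Lemma size_bits n : size (bits n) = up_log 2 n.+1.
Proof. by rewrite size_mkseq. Qed.

Definition nat_of_bits (s : seq bool) : nat :=
  foldr (fun (b : bool) n => b + n.*2) 0 s.

Lemma bitsK : cancel bits nat_of_bits.
Proof.
move=> n; have [m] := ubnP n; elim: m n => // m IH [|n] le //.
have nE := odd_double_half n.+1; rewrite -[in LHS]nE bits_cons ?nE //=.
rewrite IH ?nE //; move: nE; rewrite /=; lia.
Qed.

Lemma nat_of_bits_lt s : nat_of_bits s < 2 ^ size s.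
Proof. by elim: s => //= b s; rewrite expnS; case: b; lia. Qed.

Lemma nat_of_bits_cat s1 s2 :
  nat_of_bits (s1 ++ s2) = nat_of_bits s1 + 2 ^ size s1 * nat_of_bits s2.
Proof.
elim: s1 => [|b s IH]; first by rewrite /= mul1n.
by rewrite /= IH expnS doubleD addnA -(mul2n (_ * _)) mulnA.
Qed.

Lemma sz_bits n : sz n = sz (bits n). Proof. by []. Qed.

Lemma sz_bits_le n : sz n <= 4 * size (bits n) + 1.
Proof.
rewrite sz_bits; elim: (bits n) => // b s IH.
by rewrite sz_cons [size _]/=; have := sz_bool b; lia.
Qed.

Lemma size_bits_sz n : size (bits n) < sz n.
Proof. by rewrite sz_bits size_sz. Qed.

Lemma size_bits_mono : {homo (fun n => size (bits n)) : m n / m <= n}.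
Proof. by move=> m n mn; rewrite !size_bits leq_up_log. Qed.

Lemma size_bits_le n k : n < 2 ^ k -> size (bits n) <= k.
Proof. by rewrite size_bits => lt; apply: up_log_min. Qed.

Lemma ltn_bits n : n < 2 ^ size (bits n).
Proof. by rewrite -{1}(bitsK n) nat_of_bits_lt. Qed.

Lemma size_bitsM m n : size (bits (m * n)) <= size (bits m) + size (bits n).
Proof. by apply: size_bits_le; rewrite expnD ltn_mul ?ltn_bits. Qed.

Lemma sz_nat_le n : sz n <= 4 * n + 1.
Proof.
apply: leq_trans (sz_bits_le n) _.
by rewrite leq_add2r leq_mul2l /= size_bits_le // ltn_expl.
Qed.

Section Arithmetic.
Context (X : Type) `{Enc X}.
Implicit Types f g : X -> nat.

Lemma pt_bits f : ptime f -> ptime (fun x => bits (f x)).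
Proof. exact: ptime_eq_enc. Qed.

Lemma pt_double_add (b : X -> bool) f :
  ptime b -> ptime f -> ptime (fun x => b x + (f x).*2).
Proof.
move=> pb pf; apply: (@ptime_eq_enc _ _ _ _ _ _
  (fun x => if nilp (bits (f x)) && ~~ b x then [::] else b x :: bits (f x))).
  move=> x; case: (posnP (b x + (f x).*2)) => [E|gt0].
    by move: E; case: (b x) => //= /eqP; rewrite double_eq0 => /eqP ->.
  have ->: nilp (bits (f x)) && ~~ b x = false.
    apply/negP => /andP[/nilP fE /negbTE bE].
    by move: gt0; rewrite bE -(bitsK (f x)) fE.
  by rewrite -bits_cons.
apply: pt_if; last by apply: pt_cons => //; apply: pt_bits.
  by apply: pt_andb; [apply: pt_nilp; apply: pt_bits | apply: pt_negb].
exact: pt_cst.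
Qed.

End Arithmetic.

Lemma pt_nat_of_bits X `{Enc X} (s : X -> seq bool) :
  ptime s -> ptime (fun x => nat_of_bits (s x)).
Proof.
move=> ps; apply: (@ptime_ext _ _ _ _
  (fun x => foldl (fun n (b : bool) => b + n.*2) 0 (rev (s x)))).
  by move=> x; rewrite foldl_rev.
apply: (@pt_foldl_add _ _ _ _ _ _ _ _ _ (fun=> 4)).
- exact: pb_cst.
- move=> _ n b; case: (posnP (b + n.*2)) => [->|gt0]; first by rewrite /= addnS.
  rewrite !sz_bits bits_cons // sz_cons; have := sz_bool b; lia.
- exact: pt_rev.
- exact: pt_cst.
- by apply: pt_double_add; pt.
Qed.

(** The state of the adder: the remaining digits of both summands, the carry,
    and the digits already computed, most significant first. *)
Definition add_step (st : seq bool * seq bool * bool * seq bool) :=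
  let: (xs, ys, c, out) := st in
  let: (x, y) := (head false xs, head false ys) in
  (behead xs, behead ys, if x == y then x else c, x (+) y (+) c :: out).

(** The list [bits m ++ bits n] is only a clock, at least as long as either summand; the carry left
    at the end is the leading digit. *)
Definition add_bits m n :=
  let st := foldl (fun st (_ : bool) => add_step st) (bits m, bits n, false, [::])
              (bits m ++ bits n) in
  nat_of_bits (rev (st.1.2 :: st.2)).

Lemma add_bitsE m n : add_bits m n = m + n.
Proof.
(* Invariant: the digits already output, plus the unread parts and the carry shifted by the number
   of these digits, make up the sum. *)
suff gen (l xs ys : seq bool) c out : size xs <= size l -> size ys <= size l ->
    let st := foldl (fun st (_ : bool) => add_step st) (xs, ys, c, out) l in
    nat_of_bits (rev (st.1.2 :: st.2)) =
    nat_of_bits (rev out) + 2 ^ size out * (nat_of_bits xs + nat_of_bits ys + c).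
  by rewrite /add_bits gen ?size_cat ?leq_addr ?leq_addl //= !bitsK mul1n addn0.
elim: l xs ys c out => [|b l IH] xs ys c out.
  rewrite /= !leqn0 !size_eq0 => /eqP -> /eqP -> /=.
  by rewrite rev_cons -cats1 nat_of_bits_cat size_rev /= add0n addn0.
move=> sx sy; have hb (zs : seq bool) :
    nat_of_bits zs = head false zs + (nat_of_bits (behead zs)).*2 by case: zs.
have sb (zs : seq bool) : size zs <= (size l).+1 -> size (behead zs) <= size l.
  by rewrite size_behead; lia.
rewrite /= IH ?sb // rev_cons -cats1 nat_of_bits_cat size_rev /= expnS.
rewrite (hb xs) (hb ys); move: (nat_of_bits _) (nat_of_bits _) (nat_of_bits _).
move=> A B C; rewrite -addnA -mulnA [2 * _]mulnCA -mulnDr.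
by congr (_ + _ * _); case: (head _ xs); case: (head _ ys); case: (c) => /=; lia.
Qed.

(** Digits come least significant first, so a differing pair overrides the verdict [c] on the lower
    digits; the new verdict is [y], because [x] is then the opposite digit. *)
Definition leq_step (st : seq bool * seq bool * bool) :=
  let: (xs, ys, c) := st in
  let: (x, y) := (head false xs, head false ys) in
  (behead xs, behead ys, if x == y then c else y).

Definition leq_bits m n :=
  (foldl (fun st (_ : bool) => leq_step st) (bits m, bits n, true)
     (bits m ++ bits n)).2.

Lemma leq_bitsE m n : leq_bits m n = (m <= n).
Proof.
suff gen (l xs ys : seq bool) c : size xs <= size l -> size ys <= size l ->
    (foldl (fun st (_ : bool) => leq_step st) (xs, ys, c) l).2 =
    (nat_of_bits xs < nat_of_bits ys + c).
  by rewrite /leq_bits gen ?size_cat ?leq_addr ?leq_addl //= !bitsK addn1.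
elim: l xs ys c => [|b l IH] xs ys c.
  by rewrite /= !leqn0 !size_eq0 => /eqP -> /eqP -> /=; case: c.
move=> sx sy; have hb (zs : seq bool) :
    nat_of_bits zs = head false zs + (nat_of_bits (behead zs)).*2 by case: zs.
have sb (zs : seq bool) : size zs <= (size l).+1 -> size (behead zs) <= size l.
  by rewrite size_behead; lia.
rewrite /= IH ?sb // (hb xs) (hb ys).
by case: (head _ xs); case: (head _ ys); case: (c) => /=; lia.
Qed.

Lemma pt_addn X `{Enc X} (f g : X -> nat) : ptime f -> ptime g -> ptime (fun x => f x + g x).
Proof.
move=> pf pg; apply: (@ptime_ext _ _ _ _ (fun x => add_bits (f x) (g x))).
  by move=> x; rewrite add_bitsE.
rewrite /add_bits; apply: pt_nat_of_bits; apply: pt_rev.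
pose l x := bits (f x) ++ bits (g x).
pose s0 x : seq bool * seq bool * bool * seq bool := (bits (f x), bits (g x), false, [::]).
have pst: ptime (fun x => foldl (fun st (_ : bool) => add_step st) (s0 x) (l x)).
  apply: (@pt_foldl_add _ _ _ _ _ _ _ _ _ (fun=> 10)).
  - exact: pb_cst.
  - move=> _ [[[xs ys] c] out] _; rewrite /add_step.
    move: (_ (+) _) (if _ then _ else _) => b1 b2; rewrite !sz_pair [_.1]/= [_.2]/= sz_cons.
    have := @sz_behead bool enc_bool_inst xs.
    have := @sz_behead bool enc_bool_inst ys; have := sz_bool b1; have := sz_bool b2; rewrite /=; lia.
  - by apply: pt_cat; apply: pt_bits.
  - by rewrite /s0; pt; apply: pt_bits.
  - apply: (@ptime_ext _ _ _ _ (fun p : X * (seq bool * seq bool * bool * seq bool) * bool =>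
      let st := p.1.2 in
      let x := head false st.1.1.1 in let y := head false st.1.1.2 in
     (behead st.1.1.1, behead st.1.1.2, if x == y then x else st.1.2,
        x (+) y (+) st.1.2 :: st.2))).
      by case=> [[x [[[xs ys] c] out]] b].
    by cbv zeta; pt; apply: pt_if; pt.
by apply: pt_cons; pt.
Qed.

Lemma pt_leq X `{Enc X} (f g : X -> nat) :
  ptime f -> ptime g -> ptime (fun x => f x <= g x).
Proof.
move=> pf pg; apply: (@ptime_ext _ _ _ _ (fun x => leq_bits (f x) (g x))).
  by move=> x; rewrite leq_bitsE.
rewrite /leq_bits.
pose l x := bits (f x) ++ bits (g x).
pose s0 x : seq bool * seq bool * bool := (bits (f x), bits (g x), true).
have pst: ptime (fun x => foldl (fun st (_ : bool) => leq_step st) (s0 x) (l x)).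
  apply: (@pt_foldl_add _ _ _ _ _ _ _ _ _ (fun=> 3)).
  - exact: pb_cst.
  - move=> _ [[xs ys] c] _; rewrite /leq_step.
    move: (if _ then _ else _) => b1; rewrite !sz_pair.
    have := @sz_behead bool enc_bool_inst xs; have := @sz_behead bool enc_bool_inst ys.
    by have := sz_bool b1; rewrite /=; lia.
  - by apply: pt_cat; apply: pt_bits.
  - by rewrite /s0; pt; apply: pt_bits.
  - apply: (@ptime_ext _ _ _ _ (fun p : X * (seq bool * seq bool * bool) * bool =>
      let st := p.1.2 in
      let x := head false st.1.1 in let y := head false st.1.2 in
     (behead st.1.1, behead st.1.2, if x == y then st.2 else y))).
      by case=> [[x [[xs ys] c]] b].
    by cbv zeta; pt; apply: pt_if; pt.
exact: pt_snd pst.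
Qed.

Lemma pt_eqn X `{Enc X} (f g : X -> nat) :
  ptime f -> ptime g -> ptime (fun x => f x == g x).
Proof.
move=> pf pg; apply: (@ptime_ext _ _ _ _ (fun x => (f x <= g x) && (g x <= f x))).
  by move=> x; rewrite eqn_leq.
by apply: pt_andb; apply: pt_leq.
Qed.

(** Horner's rule from the leading digit. The term [false + acc.*2] is doubling in the form covered
    by [pt_double_add]. *)
Definition mul_bits m n :=
  foldl (fun acc (b : bool) => (if b then n else 0) + (false + acc.*2)) 0 (rev (bits m)).

Lemma mul_foldE n s :
  foldl (fun acc (b : bool) => (if b then n else 0) + (false + acc.*2)) 0 s =
  nat_of_bits (rev s) * n.
Proof.
elim/last_ind: s => // s b IH; rewrite foldl_rcons IH rev_rcons /=.
by case: b; rewrite ?mulnDl ?add0n ?mul1n -!mul2n mulnA.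
Qed.

Lemma mul_bitsE m n : mul_bits m n = m * n.
Proof. by rewrite /mul_bits mul_foldE revK bitsK. Qed.

Lemma pt_muln X `{Enc X} (f g : X -> nat) :
  ptime f -> ptime g -> ptime (fun x => f x * g x).
Proof.
move=> pf pg; apply: (@ptime_ext _ _ _ _ (fun x => mul_bits (f x) (g x))).
  by move=> x; rewrite mul_bitsE.
rewrite /mul_bits; apply: pt_foldl.
- by apply: pt_rev; apply: pt_bits.
- exact: pt_cst.
- apply: pt_addn; first by apply: pt_if; pt.
  by apply: pt_double_add; pt.
- have szf := ptime_size pf; have szg := ptime_size pg.
  have [c [d bnd]]: pbounded (fun x => 4 * (sz (f x) + sz (g x)) + 1) by pb.
  exists c, d => x l1 l2 lE; apply: leq_trans (bnd x); rewrite mul_foldE.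
  (* The digits read so far are the leading ones of [f x], so no intermediate product exceeds the
     final one. *)
  have le: nat_of_bits (rev l1) <= f x.
    rewrite -[f x]bitsK -[bits _]revK lE rev_cat nat_of_bits_cat.
    by rewrite (leq_trans _ (leq_addl _ _)) // leq_pmull // expn_gt0.
  apply: leq_trans (sz_bits_le _) _; rewrite leq_add2r leq_mul2l /=.
  apply: leq_trans (size_bits_mono (leq_mul le (leqnn _))) _.
  apply: leq_trans (size_bitsM _ _) _.
  by rewrite leq_add // ltnW // size_bits_sz.
Qed.

Lemma pt_size X A `{Enc X} `{Enc A} (l : X -> seq A) :
  ptime l -> ptime (fun x => size (l x)).
Proof.
move=> pl; have cE m (s : seq A) : foldl (fun n _ => n + 1) m s = m + size s.
  by elim: s m => [|a s IH] m /=; rewrite ?addn0 // IH addn1 addSnnS.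
apply: (@ptime_ext _ _ _ _ (fun x => foldl (fun n _ => n + 1) 0 (l x))).
  by move=> x; rewrite cE.
apply: pt_foldl => //; first exact: pt_cst.
  by apply: pt_addn; pt.
have szl := ptime_size pl.
have [c [d bnd]]: pbounded (fun x => 4 * sz (l x) + 1) by pb.
exists c, d => x l1 l2 lE; apply: leq_trans (bnd x).
rewrite cE; apply: leq_trans (sz_nat_le _) _.
rewrite leq_add2r leq_mul2l /= lE; apply: leq_trans (ltnW (size_sz _)).
by rewrite size_cat leq_addr.
Qed.

Lemma pt_count X A `{Enc X} `{Enc A} (l : X -> seq A) (F : X -> A -> bool) :
  ptime l -> ptime (fun p : X * A => F p.1 p.2) ->
  ptime (fun x => count (F x) (l x)).
Proof.
move=> pl pF; apply: (@ptime_ext _ _ _ _ (fun x => size (filter (F x) (l x)))).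
  by move=> x; rewrite size_filter.
by apply: pt_size; apply: pt_filter.
Qed.

Lemma pt_mem X `{Enc X} (f : X -> nat) (s : X -> seq nat) :
  ptime f -> ptime s -> ptime (fun x => f x \in s x).
Proof.
move=> pf ps; apply: (@ptime_ext _ _ _ _ (fun x => has (fun a => a == f x) (s x))).
  by move=> x; rewrite has_pred1.
by apply: pt_has => //; apply: pt_eqn; pt.
Qed.

Lemma pt_eqseq X `{Enc X} (f g : X -> seq nat) :
  ptime f -> ptime g -> ptime (fun x => f x == g x).
Proof.
move=> pf pg.
pose step (st : seq nat * bool) a :=
  (behead st.1, st.2 && (~~ nilp st.1 && (head 0 st.1 == a))).
have stepE (s t : seq nat) b :
    let st := foldl step (t, b) s in st.2 && nilp st.1 = b && (s == t).
  elim: s t b => [|a s IH] [|c t] b //=; rewrite ?IH /= ?andbF //.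
  by rewrite eqseq_cons [c == a]eq_sym andbA.
apply: (@ptime_ext _ _ _ _ (fun x =>
    let st := foldl step (g x, true) (f x) in st.2 && nilp st.1)).
  by move=> x; rewrite /= stepE.
have pst: ptime (fun x => foldl step (g x, true) (f x)).
  apply: (@pt_foldl_add _ _ _ _ _ _ _ _ _ (fun=> 3)).
  - exact: pb_cst.
  - move=> _ [s b] a; rewrite /step /=; move: (_ && _) => b'; rewrite !sz_pair.
    have := @sz_behead nat enc_nat_inst s.
    by have := sz_bool b'; rewrite /=; lia.
  - by [].
  - by pt.
  - by rewrite /step; pt; apply: pt_eqn; pt.
by cbv zeta; pt.
Qed.

Ltac pt_hook ::= cbv beta; lazymatch goal with
  | |- ptime (fun x => addn (@?f x) (@?g x)) => apply: (@pt_addn _ _ f g)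
  | |- ptime (fun x => muln (@?f x) (@?g x)) => apply: (@pt_muln _ _ f g)
  | |- ptime (fun x => leq (@?f x) (@?g x)) => apply: (@pt_leq _ _ f g)
  | |- ptime (fun x => size (@?f x)) => apply: (@pt_size _ _ _ _ f)
  | |- ptime (fun x => count (@?F x) (@?f x)) => apply: (@pt_count _ _ _ _ f F)
  | |- ptime (fun x => pred_of_simpl (pred1 (@?f x)) (@?g x)) => apply: (@pt_eqn _ _ g f)
  | |- ptime (fun x => @eq_op _ (@?f x) (@?g x)) =>
      first [ apply: (@pt_eqn _ _ f g) | apply: (@pt_eqseq _ _ f g) ]
  end.

(** * The dynamic program *)

Section Algorithm.
Variables (V A : eqType) (src tgt : A -> V) (capa : A -> nat).
Variable lec : rel (seq A).

Definition topo_add (E : seq A) (o : seq V) (v : V) : seq V :=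
  if (v \notin o) && all (fun a => (tgt a == v) ==> (src a \in o)) E
  then o ++ [:: v] else o.

(** Each pass over the arc heads adds at least the next level of the DAG, so
    [size E] passes suffice. *)
Definition topo (r : V) (E : seq A) : seq V :=
  foldl (topo_add E) [:: r] (flatten (map (fun=> map tgt E) E)).

(** The recursion is on [m], a constant of the algorithm, rather than on [f]: the
    corresponding program is unrolled [m] times. *)
Fixpoint expand (m : nat) (u w : V) (f : seq V) : seq (seq V) :=
  if m is m'.+1 then
    if f is x :: f' then
      let R := expand m' u w f' in
      map (cons x) R ++ (if x == u then map (cons w) R else [::])
    else [:: [::]]
  else [:: [::]].

(** [slack] stands for the terminals outside the set of the skeleton, all of them counted as if
    below [a]. Requiring [w \in f] discards arcs that carry no token. *)
Definition candidates m (E : seq A) slack (L : seq (seq V * seq A)) (w : V) :=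
  flatten (map (fun c => flatten (map (fun a =>
    map (fun f => (f, a :: c.2))
      (filter (fun f => (w \in f) && (count_mem w f + slack <= capa a))
         (expand m (src a) w c.1)))
    (filter (fun a => tgt a == w) E))) L).

(** Later moves and tests depend on the token positions alone, so of two entries with equal
    positions the dearer one can be forgotten. *)
Definition insert (L : seq (seq V * seq A)) (c : seq V * seq A) :=
  if has (fun e => (e.1 == c.1) && lec e.2 c.2) L then L
  else c :: filter (fun e => e.1 != c.1) L.

(** Folding from [L] retains the option that no token jumps to [w]. *)
Definition dp_step m E slack L w := foldl insert L (candidates m E slack L w).

(** Of [take m T] and [drop m T] only the lengths matter: the number of tokens and the number of
    remaining terminals. *)
Definition dp m (r : V) (T : seq V) (E : seq A) :=
  foldl (dp_step m E (size (drop m T))) [:: (map (fun=> r) (take m T), [::])]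
    (topo r E).

Definition complete (T : seq V) (e : seq V * seq A) :=
  all (fun v => (count_mem v e.1 <= 1) && (v \in T)) e.1.

Definition finals m r T E := filter (complete T) (dp m r T E).

Definition cheapest (L : seq (seq V * seq A)) : seq A :=
  (head ([::], [::]) (filter (fun e => all (fun e' => lec e.2 e'.2) L) L)).2.

Lemma mem_expand m u w f f' : size f <= m ->
  (f' \in expand m u w f) =
  all2 (fun p q => (q == p) || (p == u) && (q == w)) f f'.
Proof.
elim: m f f' => [|m IH] [|x f] [|y f'] //= le.
  rewrite mem_cat; apply/negP => /orP[/mapP[]|] //.
  by case: ifP => // _ /mapP[].
rewrite mem_cat -IH //.
have consE z : (y :: f' \in map (cons z) (expand m u w f)) =
    (y == z) && (f' \in expand m u w f).
  apply/mapP/andP => [[g gin [-> ->]]|[/eqP-> fin]]; first by rewrite eqxx.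
  by exists f'.
rewrite consE; case: ifP => _; first by rewrite consE andb_orl.
by rewrite in_nil !orbF.
Qed.

Lemma expand_size m u w f f' :
  size f <= m -> f' \in expand m u w f -> size f' = size f.
Proof.
by move=> le; rewrite mem_expand // all2E => /andP[/eqP].
Qed.

Lemma expand_sub m u w f f' : size f <= m -> f' \in expand m u w f ->
  {subset f' <= w :: f}.
Proof.
move=> le; rewrite mem_expand // => {le}.
elim: f f' => [|x f IH] [|y f'] //= /andP[yx /IH sub] z.
rewrite !inE => /predU1P[->|/sub]; last first.
  by rewrite inE => /orP[->|->]; rewrite ?orbT.
by case/orP: yx => [/eqP->|/andP[_ ->]] //; rewrite eqxx orbT.
Qed.

Lemma mem_candidates m E slack L w c :
  reflect (exists e a, [/\ e \in L, a \in E, tgt a = w,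
     (w \in c.1) && (count_mem w c.1 + slack <= capa a) &
     c.1 \in expand m (src a) w e.1 /\ c.2 = a :: e.2])
    (c \in candidates m E slack L w).
Proof.
apply: (iffP flatten_mapP) => [[e eL /flatten_mapP[a]]|].
  rewrite mem_filter => /andP[/eqP aw aE] /mapP[f].
  by rewrite mem_filter => /andP[fw fx] -> /=; exists e, a.
move=> [e [a [eL aE aw cw [cx c2]]]]; exists e => //; apply/flatten_mapP.
exists a; first by rewrite mem_filter aw eqxx.
apply/mapP; exists c.1; first by rewrite mem_filter cw.
by rewrite -c2; case: (c).
Qed.

Lemma mem_insert_fold L C e :
  e \in foldl insert L C -> (e \in L) || (e \in C).
Proof.
elim: C L => [|c C IH] L /=; first by move=> ->.
move/IH; rewrite inE; case/orP => [|->]; last by rewrite !orbT.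
rewrite /insert; case: ifP => _; first by move=> ->.
by rewrite inE mem_filter => /orP[->|/andP[_ ->]]; rewrite ?orbT.
Qed.

Lemma uniq_insert_fold L C :
  uniq (map fst L) -> uniq (map fst (foldl insert L C)).
Proof.
elim: C L => //= c C IH L uL; apply: IH; rewrite /insert.
case: ifP => //= _; apply/andP; split.
  by apply/mapP => -[e]; rewrite mem_filter => /andP[/eqP ne _] E; apply: ne.
by apply: subseq_uniq uL; apply: map_subseq; apply: filter_subseq.
Qed.

Section Domination.
Hypotheses (lec_refl : reflexive lec) (lec_trans : transitive lec).
Hypothesis lec_total : total lec.

Definition dominated (L : seq (seq V * seq A)) (e : seq V * seq A) :=
  exists2 e', e' \in L & e'.1 = e.1 /\ lec e'.2 e.2.

(** An entry leaves the table only in favour of one with the same positions that costs no more, so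
    domination persists. *)
Lemma dominated_insert_fold L C e :
  dominated L e \/ e \in C -> dominated (foldl insert L C) e.
Proof.
elim: C L => [|c C IH] L /=; first by case.
have new: dominated (insert L c) c.
  rewrite /insert; case: hasP => [[e' eL /andP[/eqP e1 e2]]|_]; first by exists e'.
  by exists c; rewrite ?mem_head.
case=> [dom|]; last first.
  by rewrite inE => /predU1P[ec|eC]; apply: IH; [left; rewrite ec|right].
apply: IH; left; case: dom => e' eL [e1 e2].
have [ec|nec] := eqVneq e'.1 c.1; last first.
  exists e' => //; rewrite /insert; case: ifP => // _.
  by rewrite inE mem_filter nec eL orbT.
rewrite /insert; case: ifP => H; first by exists e'.
exists c; rewrite ?mem_head // -e1 ec; split=> //.
apply: lec_trans e2; have /orP[//|h] := lec_total c.2 e'.2.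
by case/hasP: H; exists e'; rewrite // ec eqxx.
Qed.

Lemma cheapestP (L : seq (seq V * seq A)) : L != [::] ->
  exists2 e, e \in L & cheapest L = e.2 /\ {in L, forall e', lec e.2 e'.2}.
Proof.
move=> L0; suff [e eL emin] : exists2 e, e \in L & {in L, forall e', lec e.2 e'.2}.
  have : e \in filter (fun e => all (fun e' => lec e.2 e'.2) L) L.
    by rewrite mem_filter eL andbT; apply/allP.
  rewrite /cheapest; case E: (filter _ _) => [|e0 s] //= _.
  have: e0 \in e0 :: s by rewrite mem_head.
  by rewrite -E mem_filter => /andP[/allP e0min e0L]; exists e0.
elim: L L0 => // c [|d L] IH _.
  by exists c; rewrite ?mem_head // => e'; rewrite inE => /eqP ->.
have [//|e eL emin] := IH; have /orP[ce|ec] := lec_total c.2 e.2.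
  exists c; rewrite ?mem_head // => e'; rewrite inE => /predU1P[->//|/emin].
  exact: lec_trans.
exists e; first by rewrite inE eL orbT.
by move=> e'; rewrite inE => /predU1P[->//|/emin].
Qed.

End Domination.

(** Bounds the table, whose keys are distinct words over the vertices: for a constant number of
    tokens this is polynomial. *)
Lemma uniq_words_size (al : seq V) M (W : seq (seq V)) : uniq W ->
  {in W, forall f, size f = M /\ {subset f <= al}} -> size W <= size al ^ M.
Proof.
pose words M := iter M (fun W => [seq v :: f | v <- al, f <- W]) [:: [::]].
move=> uW WP; have <-: size (words M) = size al ^ M.
  by elim: (M) => //= n IH; rewrite size_allpairs IH expnS.
apply: uniq_leq_size => // f /WP[]; elim: (M) f => [|n IH] [|v f] //= [sf] sub.
apply/allpairsP; exists (v, f); split=> //=; first by apply: sub; rewrite mem_head.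
by apply: IH => // y yf; apply: sub; rewrite inE yf orbT.
Qed.

Section Shape.
Variables (m M : nat) (E : seq A) (slack : nat).
Hypothesis M_le : M <= m.

(** During the scan [n] grows by one per vertex, since an entry gains at most one arc there. *)
Definition shaped (al : seq V) n (e : seq V * seq A) :=
  [/\ size e.1 = M, {subset e.1 <= al}, size e.2 <= n & {subset e.2 <= E}].

Lemma dp_fold_shaped (al o : seq V) n L :
  {subset o <= al} -> uniq (map fst L) -> {in L, forall e, shaped al n e} ->
  uniq (map fst (foldl (dp_step m E slack) L o)) /\
  {in foldl (dp_step m E slack) L o, forall e, shaped al (n + size o) e}.
Proof.
elim: o n L => [|w o IH] n L sub uL shL; first by rewrite addn0.
rewrite /= addnS -addSn; apply: IH.
- by move=> v vo; apply: sub; rewrite inE vo orbT.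
- exact: uniq_insert_fold.
move=> e /mem_insert_fold/orP[/shL[? ? s ?]|]; first by split=> //; apply: leqW.
rewrite /shaped => /mem_candidates[e' [a [/shL[s1 s2 s3 s4] aE _ _ [ex ->]]]].
have le: size e'.1 <= m by rewrite s1.
have [sz sb] := (expand_size le ex, expand_sub le ex); split=> //=.
- by rewrite sz.
- move=> v /sb; rewrite inE => /predU1P[->|/s2//]; apply: sub; exact: mem_head.
- by move=> b; rewrite inE => /predU1P[->|/s4].
Qed.

End Shape.

End Algorithm.

(** * Invariance of the dynamic program under renaming of vertices and arcs *)

Section Naturality.
Variables (V A V' A' : eqType) (src tgt : A -> V) (src' tgt' : A' -> V').
Variables (capa : A -> nat) (capa' : A' -> nat).
Variables (lec : rel (seq A)) (lec' : rel (seq A')).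
Variables (hV : V -> V') (hA : A -> A').
Hypothesis hV_inj : injective hV.
Hypothesis srcE : forall a, src' (hA a) = hV (src a).
Hypothesis tgtE : forall a, tgt' (hA a) = hV (tgt a).
Hypothesis capaE : forall a, capa' (hA a) = capa a.
Hypothesis lecE : forall S S', lec' (map hA S) (map hA S') = lec S S'.

Let hE (e : seq V * seq A) := (map hV e.1, map hA e.2).

Lemma foldl_natural (S S' B B' : Type) (hS : S -> S') (hB : B -> B') f f' :
  (forall s b, f' (hS s) (hB b) = hS (f s b)) ->
  forall s l, foldl f' (hS s) (map hB l) = hS (foldl f s l).
Proof. by move=> fE s l; elim: l s => //= b l IH s; rewrite fE IH. Qed.

Lemma topo_natural r E : topo src' tgt' (hV r) (map hA E) = map hV (topo src tgt r E).
Proof.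
rewrite /topo -[[:: hV r]]/(map hV [:: r]).
rewrite (_ : flatten _ = map hV (flatten (map (fun=> map tgt E) E))); last first.
  rewrite map_flatten -!map_comp; congr flatten; apply: eq_map => _ /=.
  by rewrite -!map_comp; apply: eq_map => a /=.
apply: foldl_natural => o v; rewrite /topo_add mem_map // all_map.
rewrite (eq_all (a2 := fun a => (tgt a == v) ==> (src a \in o))); last first.
  by move=> a /=; rewrite tgtE srcE inj_eq // mem_map.
by case: ifP => // _; rewrite map_cat.
Qed.

Lemma expand_natural m u w f :
  expand m (hV u) (hV w) (map hV f) = map (map hV) (expand m u w f).
Proof.
elim: m f => [|m IH] [|x f] //=; rewrite IH map_cat inj_eq // -!map_comp.
by congr (_ ++ _); case: ifP => // _; rewrite -!map_comp.
Qed.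

Lemma candidates_natural m E slack L w :
  candidates src' tgt' capa' m (map hA E) slack (map hE L) (hV w) =
  map hE (candidates src tgt capa m E slack L w).
Proof.
rewrite /candidates map_flatten -!map_comp; congr flatten; apply: eq_map => c /=.
rewrite map_flatten filter_map -!map_comp; congr flatten.
rewrite (eq_filter (a2 := fun a => tgt a == w)); last first.
  by move=> a /=; rewrite tgtE inj_eq.
apply: eq_map => a /=; rewrite srcE expand_natural filter_map -!map_comp.
congr map; apply: eq_filter => f /=.
by rewrite mem_map // capaE count_map (eq_count (a2 := pred1 w)) // => v /=; rewrite inj_eq.
Qed.

Lemma insert_natural L c : insert lec' (map hE L) (hE c) = map hE (insert lec L c).
Proof.
rewrite /insert has_map filter_map.
have keyE (e : seq V * seq A) : (map hV e.1 == map hV c.1) = (e.1 == c.1).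
  by rewrite inj_eq //; apply: inj_map.
rewrite (eq_has (a2 := fun e => (e.1 == c.1) && lec e.2 c.2)); last first.
  by move=> e /=; rewrite keyE lecE.
case: ifP => // _ /=; congr (_ :: map _ _).
by apply: eq_filter => e /=; rewrite keyE.
Qed.

Lemma dp_natural m r T E :
  dp src' tgt' capa' lec' m (hV r) (map hV T) (map hA E) =
  map hE (dp src tgt capa lec m r T E).
Proof.
rewrite /dp topo_natural -map_drop -map_take size_map.
rewrite (_ : [:: _] = map hE [:: (map (fun=> r) (take m T), [::])]); last first.
  by rewrite /= /hE /= -!map_comp.
apply: foldl_natural => L w; rewrite /dp_step candidates_natural.
by apply: foldl_natural => {}L c; apply: insert_natural.
Qed.

Lemma finals_natural m r T E :
  finals src' tgt' capa' lec' m (hV r) (map hV T) (map hA E) =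
  map hE (finals src tgt capa lec m r T E).
Proof.
rewrite /finals dp_natural filter_map; congr map; apply: eq_filter => e /=.
rewrite /complete all_map; apply: eq_all => v /=.
by rewrite mem_map // count_map (eq_count (a2 := pred1 v)) // => u /=; rewrite inj_eq.
Qed.

Lemma cheapest_natural L : cheapest lec' (map hE L) = map hA (cheapest lec L).
Proof.
rewrite /cheapest filter_map.
rewrite (eq_filter (a2 := fun e => all (fun e' => lec e.2 e'.2) L)); last first.
  by move=> e /=; rewrite all_map; apply: eq_all => e' /=; rewrite lecE.
by case: filter.
Qed.

End Naturality.

(** * Running time of the algorithm *)

(** An arc [((u, v), ((p, q), c))] of the encoded instance has length [p / q]
    and capacity [c]. *)
Definition raw_arc := (nat * nat * (nat * nat * nat))%type.
Definition raw_instance := (nat * (nat * (seq nat * seq raw_arc)))%type.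
Definition raw_src (a : raw_arc) := a.1.1.
Definition raw_tgt (a : raw_arc) := a.1.2.
Definition raw_cap (a : raw_arc) := a.2.2.

(** Fractions are added without reduction: the result stays short by [raw_cost_size], and no gcd has
    to be computed. *)
Definition raw_cost_step (c : nat * nat) (a : raw_arc) :=
  (c.1 * a.2.1.2 + a.2.1.1 * c.2, c.2 * a.2.1.2).
Definition raw_cost (S : seq raw_arc) := foldl raw_cost_step (0, 1) S.
Definition raw_lec (S S' : seq raw_arc) :=
  (raw_cost S).1 * (raw_cost S').2 <= (raw_cost S').1 * (raw_cost S).2.

Definition raw_finals m (x : raw_instance) :=
  finals raw_src raw_tgt raw_cap raw_lec m x.2.1 x.2.2.1 x.2.2.2.

Lemma size_bitsD m n : size (bits (m + n)) <= size (bits m) + size (bits n) + 1.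
Proof.
apply: size_bits_le; rewrite addn1 expnS expnD.
have := ltn_bits m; have := ltn_bits n; move: (2 ^ _) (2 ^ _) => a b; nia.
Qed.

Lemma raw_cost_size S : size (bits ((raw_cost S).1 + (raw_cost S).2)) <= sz S.
Proof.
elim/last_ind: S => // S a IH; rewrite /raw_cost foldl_rcons -/(raw_cost S).
case: (raw_cost S) IH => p q; case: a => uv [[n d] c] /= IH.
(* Numerator plus denominator is submultiplicative under this addition, so the number of its digits
   is at most additive. *)
have le: p * d + n * q + q * d <= (p + q) * (n + d) by nia.
apply: leq_trans (size_bits_mono le) _; apply: leq_trans (size_bitsM _ _) _.
have -> : sz (rcons S (uv, (n, d, c))) = sz S + sz (uv, (n, d, c)) + 1.
  by elim: (S) => [|b s IHs]; rewrite ?rcons_cons !sz_cons ?IHs /sz /=; lia.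
have := size_bitsD n d; have := size_bits_sz n; have := size_bits_sz d.
by rewrite /sz in IH *; rewrite /=; lia.
Qed.

Section AlgorithmTime.
Context (X : Type) `{Enc X}.

Lemma pt_cost (S : X -> seq raw_arc) : ptime S -> ptime (fun x => raw_cost (S x)).
Proof.
move=> pS; rewrite /raw_cost; apply: pt_foldl => //; first exact: pt_cst.
  by rewrite /raw_cost_step; pt.
have szS := ptime_size pS.
have [c [d bnd]]: pbounded (fun x => 8 * sz (S x) + 3) by pb.
exists c, d => x l1 l2 lE; apply: leq_trans (bnd x).
rewrite -/(raw_cost l1) sz_pair.
have := raw_cost_size l1; move: (raw_cost l1) => -[p q] /=.
have := size_bits_mono (leq_addr q p); have := size_bits_mono (leq_addl p q).
have := sz_bits_le p; have := sz_bits_le q.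
have : sz l1 <= sz (S x).
  rewrite lE; elim: (l1) => [|a s IH]; first exact: sz_gt0.
  by rewrite cat_cons !sz_cons; lia.
by lia.
Qed.

Lemma pt_lec (S S' : X -> seq raw_arc) :
  ptime S -> ptime S' -> ptime (fun x => raw_lec (S x) (S' x)).
Proof. by move=> pS pS'; rewrite /raw_lec; pt; apply: pt_cost. Qed.

Lemma pt_drop A `{Enc A} m (s : X -> seq A) :
  ptime s -> ptime (fun x => drop m (s x)).
Proof.
elim: m s => [|m IH] s ps.
  by apply: (ptime_ext _ ps) => x; rewrite drop0.
apply: (@ptime_ext _ _ _ _ (fun x => drop m (behead (s x)))).
  by move=> x; case: (s x) => //=; case: m {IH}.
by apply: IH; apply: pt_behead.
Qed.

Lemma pt_take (A : Type) `{Enc A} (a0 : A) m (s : X -> seq A) :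
  ptime s -> ptime (fun x => take m (s x)).
Proof.
elim: m s => [|m IH] s ps.
  by apply: (@ptime_ext _ _ _ _ (fun=> [::])) (pt_cst _) => x; rewrite take0.
apply: (@ptime_ext _ _ _ _ (fun x =>
    if nilp (s x) then [::] else head a0 (s x) :: take m (behead (s x)))).
  by move=> x; case: (s x).
by apply: pt_if; pt; apply: IH; pt.
Qed.

Lemma pt_expand m (u w : X -> nat) (f : X -> seq nat) :
  ptime u -> ptime w -> ptime f -> ptime (fun x => expand m (u x) (w x) (f x)).
Proof.
move=> pu pw; elim: m f => [|m IH] f pf /=; first exact: pt_cst.
apply: (@ptime_ext _ _ _ _ (fun x =>
    let R := expand m (u x) (w x) (behead (f x)) in
    if nilp (f x) then [:: [::]] else
    map (fun t => head 0 (f x) :: t) R ++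
    (if head 0 (f x) == u x then map (fun t => w x :: t) R else [::]))).
  by move=> x; case: (f x).
have pR : ptime (fun x => expand m (u x) (w x) (behead (f x))).
  by apply: IH; apply: pt_behead.
by do 2 (apply: pt_if; pt).
Qed.

End AlgorithmTime.

Notation raw_entry := (seq nat * seq raw_arc)%type.

Lemma pt_topo X `{Enc X} (r : X -> nat) (E : X -> seq raw_arc) :
  ptime r -> ptime E -> ptime (fun x => topo raw_src raw_tgt (r x) (E x)).
Proof.
move=> pr pE; rewrite /topo.
apply: (@pt_foldl_add _ _ _ _ _ _ _ _ _ (fun p => sz p.2 + 2)).
- by pb; apply: ptime_size; pt.
- move=> x o v; rewrite /topo_add; case: ifP => _; last by lia.
  by apply: leq_trans (ltnW (sz_cat o [:: v])) _; rewrite sz_cons sz_nil /=; lia.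
- by rewrite /raw_tgt; pt.
- by pt.
- by rewrite /topo_add /raw_tgt /raw_src; apply: pt_if; pt; apply: pt_mem; pt.
Qed.

Section StepTime.
Context (X : Type) `{Enc X}.

Lemma pt_candidates m (E : X -> seq raw_arc) (k : X -> nat)
    (L : X -> seq raw_entry) (w : X -> nat) :
  ptime E -> ptime k -> ptime L -> ptime w ->
  ptime (fun x => candidates raw_src raw_tgt raw_cap m (E x) (k x) (L x) (w x)).
Proof.
move=> pE pk pL pw; rewrite /candidates /raw_src /raw_tgt /raw_cap; pt.
- by apply: pt_expand; pt.
- by apply: pt_mem; pt.
Qed.

Lemma pt_insert_fold (L C : X -> seq raw_entry) :
  ptime L -> ptime C -> ptime (fun x => foldl (insert raw_lec) (L x) (C x)).
Proof.
move=> pL pC.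
apply: (@pt_foldl_add _ _ _ _ _ _ _ _ _ (fun p => sz p.2 + 2)) => //.
- by pb; apply: (ptime_size (pt_snd pt_id)).
- move=> x l c; rewrite /insert; case: ifP => _; first by lia.
  rewrite sz_cons; have: sz [seq e <- l | e.1 != c.1] <= sz l; last by rewrite /=; lia.
  by elim: l => //= a s IH; case: ifP => _; rewrite ?sz_cons; lia.
- rewrite /insert; apply: pt_if; pt.
  by apply: pt_lec; pt.
Qed.

End StepTime.

Lemma sz_le_seq (A : eqType) `{Enc A} (s : seq A) B :
  {in s, forall a, sz a <= B} -> sz s <= size s * B.+1 + 1.
Proof.
elim: s => //= a s IH le; rewrite sz_cons.
have := le a (mem_head _ _); have := IH (fun b bs => le b (@mem_behead _ (a :: s) _ bs)).
by lia.
Qed.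

Lemma pt_dp X `{Enc X} m (r : X -> nat) (T : X -> seq nat) (E : X -> seq raw_arc) :
  ptime r -> ptime T -> ptime E ->
  ptime (fun x => dp raw_src raw_tgt raw_cap raw_lec m (r x) (T x) (E x)).
Proof.
move=> pr pT pE; rewrite /dp.
have po := pt_topo pr pE.
apply: pt_foldl => //.
- by pt; apply: pt_take => //; exact: 0.
- apply: pt_insert_fold; first by pt.
  by apply: pt_candidates; pt; apply: pt_drop; pt.
have szo := ptime_size po; have szr := ptime_size pr; have szE := ptime_size pE.
pose (n := fun x => sz (topo raw_src raw_tgt (r x) (E x))).
(* [B] bounds the size of one entry: at most [m] vertices and at most one arc per scanned vertex. *)
pose (B := fun x => (m * (sz (r x) + n x).+1 + 1) + (n x * (sz (E x)).+1 + 1) + 1).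
have [c [d bnd]]: pbounded (fun x => (n x + 1) ^ m * (B x).+1 + 1).
  by rewrite /B /n; pb.
exists c, d => x l1 l2 lE; apply: leq_trans (bnd x).
set F := foldl _ _ _.
pose o := topo raw_src raw_tgt (r x) (E x).
have szo1 : size l1 < n x.
  apply: leq_trans (size_sz o); rewrite ltnS /o lE size_cat leq_addr //.
set M := size (take m (T x)).
have Mm : M <= m by rewrite /M size_take_min geq_minl.
have [|||uF shF] := @dp_fold_shaped _ _ raw_src raw_tgt raw_cap raw_lec
  m M (E x) (size (drop m (T x))) Mm (r x :: o) l1 0
  [:: (map (fun=> r x) (take m (T x)), [::])].
- by move=> v vl; rewrite inE /o lE mem_cat vl orbT.
- by [].
- move=> e; rewrite inE => /eqP ->; split=> //=; first by rewrite size_map.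
  by move=> v /mapP[_ _ ->]; apply: mem_head.
rewrite -/F in uF shF.
have sizeF : size F <= (n x + 1) ^ m.
  rewrite -(size_map fst); apply: leq_trans (uniq_words_size (M := M) (al := r x :: o) uF _) _.
    by move=> _ /mapP[e eF ->]; have [] := shF e eF.
  have le : size (r x :: o) <= n x + 1 by rewrite /= addn1 ltnS ltnW // size_sz.
  apply: leq_trans (_ : (n x + 1) ^ M <= _); last by rewrite leq_pexp2l // addn1.
  by case: (M) => // M'; rewrite leq_exp2r.
have szF : {in F, forall e : raw_entry, sz e <= B x}.
  move=> e eF; have [s1 s2 s3 s4] := shF e eF; rewrite sz_pair.
  have sz1 : sz e.1 <= size e.1 * (sz (r x) + n x).+1 + 1.
    apply: sz_le_seq => v /s2; rewrite inE => /predU1P[->|vo]; first exact: leq_addr.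
    by apply: leq_trans (leq_addl _ _); apply: ltnW; apply: sz_mem.
  have sz2 : sz e.2 <= size e.2 * (sz (E x)).+1 + 1.
    by apply: sz_le_seq => a /s4 aE; apply: ltnW; apply: sz_mem.
  rewrite /B addn1 ltnS; apply: leq_add.
    by apply: leq_trans sz1 _; rewrite s1 leq_add2r leq_mul2r Mm orbT.
  apply: leq_trans sz2 _; rewrite leq_add2r leq_mul2r; apply/orP; right.
  by apply: leq_trans s3 _; rewrite add0n ltnW.
by apply: leq_trans (sz_le_seq szF) _; rewrite leq_add2r leq_mul2r sizeF orbT.
Qed.

Lemma pt_finals X `{Enc X} m (x : X -> raw_instance) :
  ptime x -> ptime (fun y => raw_finals m (x y)).
Proof.
move=> px; rewrite /raw_finals /finals /complete; pt.
- by apply: pt_dp; pt.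
- by apply: pt_mem; pt.
Qed.

Lemma pt_cheapest X `{Enc X} (L : X -> seq raw_entry) :
  ptime L -> ptime (fun x => cheapest raw_lec (L x)).
Proof. by move=> pL; rewrite /cheapest; pt; apply: pt_lec; pt. Qed.

Definition raw_uncap (x : raw_instance) : raw_instance :=
  (x.1, (x.2.1, (x.2.2.1,
    map (fun a => (a.1, (a.2.1, size x.2.2.1))) x.2.2.2))).

Lemma pt_uncap : ptime raw_uncap.
Proof.
apply: (@ptime_ext _ _ _ _ (fun x => (x.1, (x.2.1, (x.2.2.1,
    map (fun a => (a.1, (a.2.1, size x.2.2.1))) x.2.2.2))))) => //.
by pt.
Qed.

Definition raw_merge m (p : raw_instance * seq (nat * nat)) : seq (nat * nat) :=
  let S := map fst (cheapest raw_lec (raw_finals m p.1)) in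
  S ++ filter (fun a => a.2 \notin map snd S) p.2.

Lemma pt_merge m : ptime (raw_merge m).
Proof.
apply: (@ptime_ext _ _ _ _ (fun p : raw_instance * seq (nat * nat) =>
  map fst (cheapest raw_lec (raw_finals m p.1)) ++
  filter (fun a => a.2 \notin map snd (map fst (cheapest raw_lec (raw_finals m p.1)))) p.2)) => //.
pt; [|apply: pt_mem; pt]; by apply: pt_cheapest; apply: pt_finals; pt.
Qed.

Definition raw_feasible m (x : raw_instance) : bool := ~~ nilp (raw_finals m x).

Lemma pt_feasible m : ptime (raw_feasible m).
Proof. by apply: pt_negb; apply: pt_nilp; apply: pt_finals; pt. Qed.

(** * Trees and laminar families *)

Section Trees.
Variable n : nat.
Implicit Types (S : {set 'I_n * 'I_n}) (r u v w x y z : 'I_n).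

Lemma arc_connect S u v : (u, v) \in S -> connect (arc_rel S) u v.
Proof. by move=> uv; apply: connect1. Qed.

Lemma connect_right_ind S x (P : 'I_n -> Prop) : P x ->
  (forall u v, connect (arc_rel S) x u -> P u -> (u, v) \in S -> P v) ->
  forall y, connect (arc_rel S) x y -> P y.
Proof.
move=> Px step y /connectP[p]; elim/last_ind: p y => [|p v IH] y /=.
  by move=> _ ->.
rewrite rcons_path last_rcons => /andP[xp uv] ->.
by apply: step uv; [apply/connectP; exists p | apply: IH].
Qed.

Lemma connect_last_arc S x y : connect (arc_rel S) x y ->
  x = y \/ exists2 u, (u, y) \in S & connect (arc_rel S) x u.
Proof.
move: y; apply: connect_right_ind; first by left.
by move=> u v xu _ uv; right; exists u.
Qed.

Lemma connect_subset S S' x y : S \subset S' ->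
  connect (arc_rel S) x y -> connect (arc_rel S') x y.
Proof.
move=> /subsetP sub; apply: connect_sub => u v uv; apply: arc_connect.
exact: sub.
Qed.

Lemma connect_antisym S x y :
  (forall p, cycle (arc_rel S) p -> p = [::]) ->
  connect (arc_rel S) x y -> connect (arc_rel S) y x -> x = y.
Proof.
move=> dag /connectP[p xp ->] /connectP[q]; move: xp.
have [pq|[s [z pq]]] : p ++ q = [::] \/ exists s z, p ++ q = rcons s z.
    by case: (lastP (p ++ q)) => [|s z]; [left | right; exists s, z].
  by case: p pq.
move=> xp pq' xE; have: path (arc_rel S) x (rcons s z) by rewrite -pq cat_path xp.
have <-: x = z by rewrite xE -last_cat pq last_rcons.
by move=> /(dag (x :: s)).
Qed.

(** Entering arcs are unique, so the two paths to [z] agree when followed backwards, until one of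
    them ends. *)
Lemma tree_ancestors_comparable r S x y z : tree_away_from r S ->
  connect (arc_rel S) x z -> connect (arc_rel S) y z ->
  connect (arc_rel S) x y \/ connect (arc_rel S) y x.
Proof.
move=> [_ _ uniq_in]; move: z.
apply: connect_right_ind; first by right.
move=> u v xu IH uv /connect_last_arc[->|[u' u'v yu']].
  by left; apply: connect_trans xu (arc_connect uv).
by apply: IH; have [<-] := uniq_in _ _ u'v uv erefl.
Qed.

Lemma connect_tree_vertices r S v :
  connect (arc_rel S) r v -> v \in tree_vertices r S.
Proof.
case/connect_last_arc => [<-|[u uv _]]; rewrite !inE ?eqxx //.
by apply/orP; right; apply/orP; right; apply/imsetP; exists (u, v).
Qed.

Lemma tree_verticesE r S v : tree_away_from r S ->
  (v \in tree_vertices r S) = connect (arc_rel S) r v.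
Proof.
move=> [conn _ _]; apply/idP/idP; first exact: conn.
exact: connect_tree_vertices.
Qed.

Lemma arc_tree_vertices r S a : a \in S ->
  a.1 \in tree_vertices r S /\ a.2 \in tree_vertices r S.
Proof.
move=> aS; rewrite !inE; split; apply/orP; right; apply/orP.
  by left; apply: imset_f.
by right; apply: imset_f.
Qed.

Lemma subtree_laminar r S u v : tree_away_from r S ->
  [|| [disjoint subtree S u & subtree S v], subtree S u \subset subtree S v
    | subtree S v \subset subtree S u].
Proof.
move=> tree; rewrite -setI_eq0; case: eqP => //= /eqP/set0Pn[z].
rewrite !inE => /andP[uz vz].
case: (tree_ancestors_comparable tree uz vz) => [uv|vu].
  by apply/orP; right; apply/subsetP => y; rewrite !inE; apply: connect_trans.
by apply/orP; left; apply/subsetP => y; rewrite !inE; apply: connect_trans.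
Qed.

End Trees.

(** Each round adds two elements of [T] that no member of the family missing
    a part of [T] not yet chosen contains both. *)
Lemma laminar_select (V : finType) (P : pred {set V}) (T : {set V}) k :
  (forall F G, P F -> P G ->
     [|| [disjoint F & G], F \subset G | G \subset F]) ->
  exists A : {set V}, [/\ A \subset T, #|A| <= k.*2 &
    forall F, P F -> minn k #|T :\: F| <= #|A :\: F|].
Proof.
move=> laminar; elim: k => [|k [A [AT Ak sel]]].
  by exists set0; rewrite sub0set cards0; split=> // F _; rewrite min0n.
(* A member containing all unchosen elements misses only chosen ones, so it asks for nothing
   more. *)
have mono (A' F : {set V}) : A \subset A' -> T :\: A \subset F -> T :\: F \subset A' :\: F.
  move=> /subsetP AA' /subsetP sub; apply/subsetP => z; rewrite !inE.
  case/andP=> zF zT; rewrite zF AA' //; apply: contraNT zF => zA.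
  by apply: sub; rewrite inE zA zT.
have [TA0|[x]] := set_0Vmem (T :\: A); last rewrite !inE => /andP[xA xT].
  exists A; split=> //; first by rewrite doubleS (leq_trans Ak) // !leqW.
  by move=> F PF; rewrite geq_min (subset_leq_card (mono _ _ (subxx A) _)) ?TA0 ?sub0set ?orbT.
have [y [yA yT sep]]: exists y, [/\ y \notin A, y \in T &
    forall F, P F -> ~~ (T :\: A \subset F) -> (x \notin F) || (y \notin F)].
  (* Among the members through [x] that still miss an unchosen element, [F0] has the most unchosen
     elements, and [y] is one that it misses. Such a member containing [x] and [y] would include
     [F0] by laminarity, and have more of them. If no member qualifies, [y = x] will do. *)
  pose Q F := [&& P F, x \in F & ~~ (T :\: A \subset F)].
  have [F1 QF1|Q0] := pickP Q; last first.
    by exists x; split=> // F PF nF; have := Q0 F; rewrite /Q PF nF andbT => /= ->.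
  case: (@arg_maxnP _ F1 Q (fun F => #|F :&: (T :\: A)|) QF1) => F0 /and3P[PF0 xF0 nF0] max0.
  have /subsetPn[y] := nF0; rewrite !inE => /andP[yA yT] yF0.
  exists y; split=> // F PF nF; rewrite -negb_and; apply/negP => /andP[xF yF].
  have /or3P[dis|sub|sub] := laminar _ _ PF PF0.
  - by move: dis; rewrite -setI_eq0 => /eqP/setP/(_ x); rewrite !inE xF xF0.
  - by move: yF0; rewrite (subsetP sub).
  have le: #|F :&: (T :\: A)| <= #|F0 :&: (T :\: A)|.
    by apply: max0; rewrite /Q PF xF nF.
  suff: #|F0 :&: (T :\: A)| < #|F :&: (T :\: A)| by rewrite ltnNge le.
  apply: proper_card; apply/properP; split; first exact: setSI.
  by exists y; rewrite !inE ?yF ?yA ?yT // (negbTE yF0).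
exists (x |: (y |: A)); split.
- by rewrite !subUset !sub1set xT yT AT.
- by rewrite doubleS cardsU1 cardsU1; move: (_ \notin _) (_ \notin _) => [] [] /=; lia.
move=> F PF; have AA' : A \subset x |: (y |: A).
  by apply/subsetP => z zA; rewrite !inE zA !orbT.
have [sub|nsub] := boolP (T :\: A \subset F).
  by rewrite geq_min (subset_leq_card (mono _ _ AA' sub)) orbT.
(* One more element outside [F] pays for the passage from [k] to [k.+1]. *)
suff lt: #|A :\: F| < #|(x |: (y |: A)) :\: F|.
  by have := sel F PF; move: lt; rewrite /minn; do 2 case: ifP; lia.
apply: proper_card; apply/properP; split; first exact: setSD.
have [z [zx zA zF]]: exists z, [/\ z \in [set x; y], z \notin A & z \notin F].
  by case/orP: (sep F PF nsub) => h; [exists x | exists y]; rewrite !inE eqxx ?orbT.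
exists z; last by rewrite inE negb_and zA orbT.
by move: zx; rewrite !inE zF => /orP[] ->; rewrite ?orbT.
Qed.

Lemma subset_of_card (V : finType) (A T : {set V}) m :
  A \subset T -> #|A| <= m <= #|T| ->
  exists B : {set V}, [/\ A \subset B, B \subset T & #|B| = m].
Proof.
move=> AT /andP[Am mT].
have [d dE] : exists d, m = #|A| + d by exists (m - #|A|); rewrite subnKC.
elim: d A AT Am dE => [|d IH] A AT Am dE; first by exists A; rewrite dE addn0.
have /properP[_ [x xT xA]]: A \proper T.
  by rewrite properEcard AT /=; apply: leq_trans mT; rewrite dE addnS leq_addr.
have [|||B [xAB BT Bm]] := IH (x |: A).
- by rewrite subUset sub1set xT.
- by rewrite cardsU1 xA dE; lia.
- by rewrite cardsU1 xA dE; lia.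
by exists B; split=> //; apply: subset_trans xAB; apply: subsetUr.
Qed.

(** * Skeletons *)

(** A skeleton already provides, outside the subtree of each of its arcs, all
    the terminals that the capacity of this arc requires to be there. *)
Definition skeleton (I : instance) (M : nat) (A : {set 'I_(order I)})
    (S : {set 'I_(order I) * 'I_(order I)}) : Prop :=
  [/\ S \subset arcs I, tree_away_from (root I) S,
      A \subset terminals I :&: tree_vertices (root I) S, #|A| = M
    & forall a, a \in S ->
        #|subtree S a.2 :&: A| + (#|terminals I| - M) <= cap I a].
Arguments skeleton : clear implicits.

(** The root is no head of an arc in [S]; this is harmless, as the tree [S'] has no arc into the
    root. *)
Definition graft (V : finType) (S S' : {set V * V}) : {set V * V} :=
  S :|: [set a in S' | a.2 \notin [set b.2 | b in S]].

Section Instance.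
Variable I : instance.
Implicit Types (S : {set 'I_(order I) * 'I_(order I)}) (A : {set 'I_(order I)}).

(** Grafted arcs enter no vertex of [S], so such a vertex has the same ancestors as in [S]. Hence an
    arc of [S] gets no new element of [A] below it, a grafted arc has none at all, and only [K - M]
    terminals lie outside [A]. *)
Lemma graft_feasible M A S S' : skeleton I M A S ->
  (forall a, a \in arcs I -> #|terminals I| - M <= cap I a) ->
  S' \subset arcs I -> tree_away_from (root I) S' ->
  terminals I \subset tree_vertices (root I) S' ->
  feasible I (graft S S').
Proof.
move=> [SE treeS AS AM capS] capM S'E treeS' TS'.
have memG a : (a \in graft S S') =
    (a \in S) || (a \in S') && (a.2 \notin [set b.2 | b in S]) by rewrite !inE.
have SG : S \subset graft S S' by apply: subsetUl.
have headS v : (v \in [set b.2 | b in S]) -> exists u, (u, v) \in S.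
  by case/imsetP => -[u w] uw ->; exists u.
have [connS rootS inS] := treeS; have [connS' rootS' inS'] := treeS'.
have rootG a : a \in graft S S' -> a.2 != root I.
  by rewrite memG => /orP[/rootS|/andP[/rootS']].
(* Following [S'] from the root, a head of [S] is reached inside [S] instead of through the
   discarded arc. *)
have reach v : connect (arc_rel S') (root I) v ->
    connect (arc_rel (graft S S')) (root I) v.
  move: v; apply: connect_right_ind; first exact: connect0.
  move=> u v _ ru uv; have [vS|nvS] := boolP (v \in [set b.2 | b in S]).
    have [w /(arc_tree_vertices (root I))[_ /connS]] := headS _ vS.
    exact: connect_subset.
  by apply: connect_trans ru (arc_connect _); rewrite memG uv nvS orbT.
have arcS a : a \in graft S S' -> a.2 \in tree_vertices (root I) S -> a \in S.
  move=> aG; rewrite tree_verticesE // => /connect_last_arc[E|[u uS _]].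
    by have := rootG a aG; rewrite -E eqxx.
  move: aG; rewrite memG => /orP[//|/andP[_ /imsetP[]]].
  by exists (u, a.2).
have back v t : t \in tree_vertices (root I) S ->
    connect (arc_rel (graft S S')) v t ->
    v \in tree_vertices (root I) S /\ connect (arc_rel S) v t.
  move=> tS vt; move: t vt tS; apply: connect_right_ind; first by split.
  move=> u t _ IH ut tS; have utS := arcS _ ut tS.
  have [uS _] := arc_tree_vertices (root I) utS.
  have [vS vu] := IH uS; split=> //; exact: connect_trans vu (arc_connect utS).
split.
- apply/subsetP => a; rewrite memG => /orP[|/andP[+ _]]; exact/subsetP.
- split=> // [v|a b].
    have ends a : a \in graft S S' ->
        connect (arc_rel (graft S S')) (root I) a.1 /\
        connect (arc_rel (graft S S')) (root I) a.2.
      rewrite memG => /orP[aS|/andP[aS _]].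
        have [/connS r1 /connS r2] := arc_tree_vertices (root I) aS.
        by split; apply: connect_subset SG _.
      have [/connS' r1 /connS' r2] := arc_tree_vertices (root I) aS.
      by split; apply: reach.
    rewrite !inE; case/or3P => [/eqP->|/imsetP[a aG ->]|/imsetP[a aG ->]].
    + exact: connect0.
    + by have [] := ends a aG.
    + by have [] := ends a aG.
  rewrite !memG => /orP[aS|/andP[aS' na]] /orP[bS|/andP[bS' nb]] ab.
  + exact: inS.
  + by case/imsetP: nb; exists a.
  + by case/imsetP: na; exists b.
  + exact: inS'.
- apply/subsetP => t tT; apply: connect_tree_vertices; apply: reach.
  by rewrite -tree_verticesE // (subsetP TS').
move=> a aG; have AT : A \subset terminals I by apply: subset_trans AS (subsetIl _ _).
have AV t : t \in A -> t \in tree_vertices (root I) S.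
  by move/(subsetP AS); rewrite inE => /andP[].
have aE : a \in arcs I.
  by move: aG; rewrite memG => /orP[|/andP[+ _]]; apply/subsetP.
have cardTA : #|terminals I :\: A| = #|terminals I| - M.
  by rewrite cardsD (setIidPr AT) AM.
have le : #|subtree (graft S S') a.2 :&: terminals I| <=
    #|subtree (graft S S') a.2 :&: A| + (#|terminals I| - M).
  rewrite -cardTA; apply: leq_trans (leq_card_setU _ _); apply: subset_leq_card.
  by apply/subsetP => z; rewrite !inE => /andP[-> ->]; rewrite /= andbT orbN.
apply: leq_trans le _; have [aS|naS] := boolP (a \in S).
  apply: leq_trans (capS _ aS); rewrite leq_add2r; apply: subset_leq_card.
  apply/subsetP => t; rewrite !inE => /andP[at_ tA]; rewrite tA andbT.
  by have [] := back _ _ (AV _ tA) at_.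
rewrite (_ : subtree _ _ :&: A = set0) ?cards0 ?add0n ?capM //.
apply/eqP; rewrite -subset0; apply/subsetP => t; rewrite !inE => /andP[at_ tA].
have [aV _] := back _ _ (AV _ tA) at_.
by rewrite (arcS _ aG aV) in naS.
Qed.

Hypothesis wf : well_formed I.
Hypothesis dag : is_dag I.

Lemma total_len_graft S S' : S \subset arcs I -> S' \subset arcs I ->
  (total_len I (graft S S') <= total_len I S + total_len I S')%R.
Proof.
case: wf => _ _ _ len_ge0 _ SE S'E; rewrite /total_len /graft.
set S1 := [set a in S' | _].
have dis : [disjoint S & S1].
  rewrite disjoint_subset; apply/subsetP => a aS; rewrite !inE negb_and negbK.
  by rewrite imset_f ?orbT.
have -> : (\sum_(a in S :|: S1) len I a =
    \sum_(a in S) len I a + \sum_(a in S1) len I a)%R by rewrite -bigU //; apply: eq_bigl => a; rewrite !inE.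
rewrite lerD2l [leRHS](big_setID S1) /=.
have S1S : S1 \subset S' by apply/subsetP => a; rewrite inE => /andP[].
rewrite (setIidPr S1S) lerDl sumr_ge0 // => a; rewrite inE => /andP[_ aS'].
by apply: len_ge0; apply: (subsetP S'E).
Qed.

(** The root reaches every vertex, so an arc into it would close a circuit. *)
Lemma no_arc_to_root u : (u, root I) \notin arcs I.
Proof.
apply/negP => ur; case: wf => _ _ reach _ _.
have uE : u = root I by apply: connect_antisym dag (arc_connect ur) (reach u).
by have := @dag [:: u]; rewrite /= /arc_rel {2}uE ur => /(_ isT).
Qed.

(** Their number increases strictly along arcs and serves as the level of a vertex in inductions on
    the DAG. *)
Definition ancestors (v : 'I_(order I)) := [set x | connect (arc_rel (arcs I)) x v].

Lemma ancestors_proper u v : (u, v) \in arcs I -> ancestors u \proper ancestors v.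
Proof.
move=> uv; apply/properP; split.
  by apply/subsetP => x; rewrite !inE => xu; apply: connect_trans xu (arc_connect uv).
exists v; rewrite !inE ?connect0 //; apply/negP => vu.
have E := connect_antisym dag vu (arc_connect uv).
by have := @dag [:: u]; rewrite /= /arc_rel {2}(esym E) uv => /(_ isT).
Qed.

Lemma in_arc v : v != root I -> exists u, (u, v) \in arcs I.
Proof.
case: wf => _ _ /(_ v) /connect_last_arc[->|[u uv _] _]; first by rewrite eqxx.
by exists u.
Qed.

(** In a DAG any choice of one entering arc per vertex other than the root gives a tree: going
    backwards has to stop, and can stop only at the root. *)
Lemma spanning_tree : exists S', [/\ S' \subset arcs I,
  tree_away_from (root I) S' & terminals I \subset tree_vertices (root I) S'].
Proof.
pose p v := [pick u | (u, v) \in arcs I].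
pose S' := [set a | p a.2 == Some a.1].
have S'E : S' \subset arcs I.
  apply/subsetP => -[u v]; rewrite inE /p /=; case: pickP => // x xv.
  by move=> /eqP[<-].
have reach v : connect (arc_rel S') (root I) v.
  have [m] := ubnP #|ancestors v|; elim: m v => // m IH v le.
  have [->|vr] := eqVneq v (root I); first exact: connect0.
  have [u uv] : exists u, p v = Some u.
    rewrite /p; case: pickP => [x|]; first by exists x.
    by have [u uv] := in_arc vr => /(_ u); rewrite uv.
  have uvS : (u, v) \in S' by rewrite inE uv.
  apply: connect_trans (arc_connect uvS); apply: IH.
  have uvE := subsetP S'E _ uvS.
  by have := proper_card (ancestors_proper uvE); move: le; lia.
exists S'; split=> //; last first.
  by apply/subsetP => t _; apply: connect_tree_vertices.
split=> [v _|[u v] /(subsetP S'E)|[u v] [u' v']] //=.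
  by move=> uv; apply: contraTneq uv => ->; apply: no_arc_to_root.
by rewrite !inE /= => /eqP uv /eqP + vv'; rewrite -vv' uv => -[->].
Qed.

Variable k : nat.
Hypothesis large : forall a, a \in arcs I -> #|terminals I| <= cap I a + k.
Let M := minn k.*2 #|terminals I|.

Lemma large_cap a : a \in arcs I -> #|terminals I| - M <= cap I a.
Proof. by move/large; rewrite /M; lia. Qed.

Lemma feasible_skeleton S : feasible I S -> exists A, skeleton I M A S.
Proof.
move=> [SE tree TS capS].
pose P F := [exists v, F == subtree S v].
have [|A [AT Ak sel]] := @laminar_select _ P (terminals I) k.
  by move=> F G /existsP[u /eqP->] /existsP[v /eqP->]; apply: subtree_laminar tree.
(* [A] is padded to exactly [M] elements, one per token; this cannot decrease the number of them
   outside a subtree. *)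
have [|B [AB BT BM]] := @subset_of_card _ A (terminals I) M AT.
  by rewrite /M leq_min Ak subset_leq_card //= geq_minr.
exists B; split=> //; first by rewrite subsetI BT (subset_trans BT TS).
move=> a aS; set F := subtree S a.2.
have PF : P F by apply/existsP; exists a.2.
have selB : minn k #|terminals I :\: F| <= #|B :\: F|.
  exact: leq_trans (sel F PF) (subset_leq_card (setSD _ AB)).
have := capS a aS; have := large (subsetP SE _ aS); rewrite -/F.
have := cardsID F B; have := cardsID F (terminals I).
rewrite [F :&: B]setIC [F :&: _]setIC BM.
have : M <= #|terminals I| by rewrite /M geq_minr.
by move: selB; lia.
Qed.

End Instance.

(** * Topological order *)

Section TopologicalOrder.
Variable I : instance.
Hypothesis wf : well_formed I.
Hypothesis dag : is_dag I.
Notation V := 'I_(order I).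
Let E := enum (arcs I).
Let add := topo_add fst snd E.
Implicit Types (o : seq V) (v : V).

Let memE (a : V * V) : (a \in E) = (a \in arcs I). Proof. exact: mem_enum. Qed.

Definition topological o := uniq o /\
  forall o1 w o2, o = o1 ++ w :: o2 -> forall u, (u, w) \in arcs I -> u \in o1.

Lemma topo_add_topological o v : topological o -> topological (add o v).
Proof.
move=> [uo ordo]; rewrite /add /topo_add.
case: ifP => // /andP[vo /allP predv]; split; first by rewrite cats1 rcons_uniq vo.
move=> o1 w o2; case: (lastP o2) => [|o2' z].
  rewrite !cats1 => /rcons_inj[<- <-] u uv.
  by have := predv (u, v); rewrite memE uv /= eqxx => /(_ isT).
by rewrite cats1 -rcons_cons -rcons_cat => /rcons_inj[/ordo].
Qed.

Lemma topo_fold_topological o l : topological o -> topological (foldl add o l).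
Proof. by elim: l o => //= v l IH o /(topo_add_topological v)/IH. Qed.

Lemma mem_topo_fold o l v : v \in o -> v \in foldl add o l.
Proof.
elim: l o => //= w l IH o vo; apply: IH; rewrite /add /topo_add.
by case: ifP => // _; rewrite mem_cat vo.
Qed.

Lemma topo_fold_complete o l v : v \in l ->
  (forall u, (u, v) \in arcs I -> u \in o) -> v \in foldl add o l.
Proof.
elim: l o => // w l IH o; rewrite inE => /predU1P[<-|vl] pred /=; last first.
  apply: IH => // u /pred uo; exact: (@mem_topo_fold o [:: w]).
apply: mem_topo_fold; rewrite /add /topo_add; case: ifP => [_|].
  by rewrite mem_cat mem_head orbT.
case: (boolP (v \in o)) => //= _ /allPn[[u v'] uv].
rewrite negb_imply /= => /andP[/eqP vv] /negP[]; apply: pred.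
by rewrite -memE -vv.
Qed.

(** After [j] passes every vertex with at most [j.+1] ancestors is listed, because its predecessors
    have fewer. Every vertex except the root is the head of an arc, so there are at most
    [(size E).+1] vertices. *)
Lemma topoP : topological (topo fst snd (root I) E) /\
  forall v, v \in topo fst snd (root I) E.
Proof.
have start : topological [:: root I].
  split=> // o1 w o2; case: o1 => [[<- _]|x [|]] // u uv.
  by have := no_arc_to_root wf dag u; rewrite uv.
split; first exact: topo_fold_topological.
have head_arc v : v != root I -> v \in map snd E.
  by case/(in_arc wf) => u uv; apply/mapP; exists (u, v); rewrite ?memE.
have sizeE : #|V| <= (size E).+1.
  rewrite -(size_map snd) -/(size (root I :: map snd E)).
  apply: leq_trans (card_size _); apply: subset_leq_card; apply/subsetP => v _.
  by rewrite inE; case: eqVneq => //= /head_arc.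
have pass j v : #|ancestors v| <= j.+1 ->
    v \in foldl add [:: root I] (flatten (nseq j (map snd E))).
  have [->|vr] := eqVneq v (root I); first by move=> _; rewrite mem_topo_fold ?mem_head.
  elim: j v vr => [|j IH] v vr le.
    case/eqP: vr; have /card_le1P : #|ancestors v| <= 1 by [].
    case: wf => _ _ /(_ v) rv _ _; move/(_ (root I)).
    by rewrite inE rv => /(_ isT v); rewrite !inE connect0 => /esym/eqP.
  rewrite -addn1 nseqD flatten_cat foldl_cat /= cats0.
  apply: topo_fold_complete; first exact: head_arc.
  move=> u uv; have [->|ur] := eqVneq u (root I).
    by rewrite mem_topo_fold ?mem_head.
  by apply: IH => //; have := proper_card (ancestors_proper dag uv); move: le; lia.
move=> v; rewrite /topo (_ : map _ _ = nseq (size E) (map snd E)).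
  by apply: pass; apply: leq_trans (max_card _) sizeE.
by move: (map snd E) => H; elim: (E) => //= a s ->.
Qed.

End TopologicalOrder.

(** * Correctness of the dynamic program *)

(** Absolute values appear because the encoding drops the sign of a length; on arcs of a well-formed
    instance they change nothing. *)
Definition abs_len (I : instance) (S : seq ('I_(order I) * 'I_(order I))) : rat :=
  (\sum_(a <- S) `|len I a|)%R.

Definition len_lec (I : instance) : rel (seq ('I_(order I) * 'I_(order I))) :=
  fun S S' => (abs_len S <= abs_len S')%R.

Lemma len_lec_refl I : reflexive (@len_lec I).
Proof. by move=> S; apply: lexx. Qed.

Lemma len_lec_trans I : transitive (@len_lec I).
Proof. by move=> S1 S2 S3; apply: le_trans. Qed.

Lemma len_lec_total I : total (@len_lec I).
Proof. by move=> S S'; apply: le_total. Qed.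

Lemma abs_len_total_len I (S : seq ('I_(order I) * 'I_(order I))) :
  well_formed I -> {subset S <= arcs I} -> uniq S ->
  abs_len S = total_len I [set a in S].
Proof.
case=> _ _ _ len_ge0 _ sub uS; rewrite /total_len /abs_len.
have -> : (\sum_(a in [set a in S]) len I a = \sum_(a in S) len I a)%R.
  by apply: eq_bigl => a; rewrite inE.
rewrite -big_uniq //= [LHS]big_seq_cond [RHS]big_seq_cond.
by apply: eq_bigr => a /andP[/sub/len_ge0 ge0 _]; rewrite ger0_norm.
Qed.

(** As [w] is isolated in [S], the new arc can only be the last one of a path. *)
Lemma connect_add_leaf n (S : {set 'I_n * 'I_n}) (u w x y : 'I_n) :
  (forall v, (v, w) \notin S) -> (forall v, (w, v) \notin S) -> u != w ->
  connect (arc_rel ((u, w) |: S)) x y =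
  if y == w then (x == w) || connect (arc_rel S) x u else connect (arc_rel S) x y.
Proof.
move=> no_in no_out uw; apply/idP/idP; last first.
  case: eqVneq => [-> /orP[/eqP->|xu]|_]; first exact: connect0.
    apply: connect_trans (connect_subset (subsetUr _ _) xu) (arc_connect _).
    by rewrite setU11.
  exact: connect_subset (subsetUr _ _).
move: y; apply: connect_right_ind; first by case: eqP => // _; apply: connect0.
move=> v v' _ IH; rewrite in_setU1 => /predU1P[[vu ->]|vS].
  by rewrite eqxx; move: IH; rewrite vu (negbTE uw) => ->; rewrite orbT.
have [v'w|_] := eqVneq v' w; first by move: vS; rewrite v'w (negbTE (no_in v)).
have vw : v != w by apply: contraTneq vS => ->.
by move: IH; rewrite (negbTE vw) => xv; apply: connect_trans xv (arc_connect vS).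
Qed.

Lemma all2_imp_in (X Y : eqType) (P Q : X -> Y -> bool) s t :
  {in t, forall y x, P x y -> Q x y} -> all2 P s t -> all2 Q s t.
Proof.
elim: s t => [|x s IH] [|y t] //= PQ /andP[xy st].
rewrite PQ ?mem_head //=; apply: IH st => z zt; apply: PQ.
by rewrite inE zt orbT.
Qed.

(** Here [s] lists token positions, [t] their destinations, and [g] moves a token: this form
    compares old positions with new ones, the next one new positions with destinations. *)
Lemma all2_map_zip_r (X Y Z : eqType) (P : X -> Y -> bool) (Q : X -> Z -> bool)
    (g : X * Y -> Z) s t :
  {in t, forall y x, P x y -> Q x (g (x, y))} -> all2 P s t ->
  all2 Q s (map g (zip s t)).
Proof.
elim: s t => [|x s IH] [|y t] //= PQ /andP[xy st].
rewrite PQ ?mem_head //=; apply: IH st => z zt; apply: PQ.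
by rewrite inE zt orbT.
Qed.

Lemma all2_map_zip_l (X Y Z : eqType) (P : X -> Y -> bool) (Q : Z -> Y -> bool)
    (g : X * Y -> Z) s t :
  {in t, forall y x, P x y -> Q (g (x, y)) y} -> all2 P s t ->
  all2 Q (map g (zip s t)) t.
Proof.
elim: s t => [|x s IH] [|y t] //= PQ /andP[xy st].
rewrite PQ ?mem_head //=; apply: IH st => z zt; apply: PQ.
by rewrite inE zt orbT.
Qed.

Section Correctness.
Variable I : instance.
Hypothesis wf : well_formed I.
Hypothesis dag : is_dag I.
Notation V := 'I_(order I).
Notation r := (root I).
Variable m : nat.
Let E := enum (arcs I).
Let T := enum (terminals I).
Let M := size (take m T).
Let slack := size (drop m T).
Let step := dp_step fst snd (cap I) (@len_lec I) m E slack.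
Implicit Types (o f : seq V) (S : seq (V * V)).

Let memE (a : V * V) : (a \in E) = (a \in arcs I). Proof. exact: mem_enum. Qed.

Let slackE : slack = #|terminals I| - M.
Proof. by rewrite /slack /M size_drop size_take_min cardE -/T; lia. Qed.

Definition reaches S (x y : V) := connect (arc_rel [set a in S]) x y.

(** Distinct heads and reachable tails make [S] a tree. Testing capacities at the present positions
    is enough, because a later jump does not change which of the earlier arcs a token lies below. *)
Definition sound o (e : seq V * seq (V * V)) := let f := e.1 in let S := e.2 in
  [/\ {subset S <= arcs I}, uniq (map snd S) /\ {subset map snd S <= o},
      size f = M /\ {in f, forall v, reaches S r v},
      {in S, forall a, reaches S r a.1}
    & {in S, forall a, count (reaches S a.2) f + slack <= cap I a}].

Lemma reaches_heads S x v : reaches S x v -> (x == v) || (v \in map snd S).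
Proof.
case/connect_last_arc => [->|[u]]; rewrite ?eqxx // inE => uvS _.
by apply/orP; right; apply/mapP; exists (u, v).
Qed.

(** The vertex [w] joins as a leaf: the tokens below the new arc are those on [w], and a token
    jumping from [u] to [w] stays below the same older arcs. *)
Lemma sound_step o1 w L : {in L, forall e, sound o1 e} -> w \notin o1 ->
  {in step L w, forall e, sound (o1 ++ [:: w]) e}.
Proof.
move=> soundL wo [f' S'] /mem_insert_fold/orP[/soundL|].
  case=> SE [uS So] ? ? ?; split=> //; split=> // v /So.
  by rewrite mem_cat => ->.
case/mem_candidates => -[f S] [[u w'] [/soundL[SE [uS So] [sf fS] tails caps]]] /=.
rewrite memE => aE w'w; rewrite {w'}w'w in aE * => /andP[wf' le] [fx ->] {S'}.
have wr : w != r by apply: contraTneq aE => ->; apply: no_arc_to_root.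
have uw : u != w.
  apply: contraTneq aE => ->; apply/negP => ww.
  by have := @dag [:: w]; rewrite /= /arc_rel ww => /(_ isT).
have nreach v : reaches S r v -> v != w.
  move/reaches_heads => /predU1P[<-|/So vo]; first by rewrite eq_sym.
  by apply: contraNneq wo => <-.
have no_in v : (v, w) \notin [set a in S].
  rewrite inE; apply/negP => vw; have /So : w \in map snd S by apply/mapP; exists (v, w).
  by rewrite (negbTE wo).
have no_out v : (w, v) \notin [set a in S].
  by rewrite inE; apply/negP => /tails/nreach; rewrite eqxx.
have setE : [set a in (u, w) :: S] = (u, w) |: [set a in S].
  by apply/setP => a; rewrite !inE.
have reachE x y : reaches ((u, w) :: S) x y =
    if y == w then (x == w) || reaches S x u else reaches S x y.
  by rewrite /reaches setE connect_add_leaf.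
have sM : size f <= m by rewrite sf /M size_take_min geq_minl.
have sub := expand_sub sM fx; have sz' := expand_size sM fx.
move: fx; rewrite mem_expand // => fx.
have fw : {in f, forall v, v != w} by move=> v /fS/nreach.
(* No token stood on [w] before the jump and one does now, so it came from [u]; hence [S] reaches
   [u]. *)
have uf : u \in f.
  have : has (pred1 w) f' by rewrite has_pred1.
  elim: (f) (f') fx fw => [|x g IH] [|y g'] //= /andP[yx gx] gw.
  rewrite inE => /orP[/eqP yw|/IH H]; last first.
    by rewrite H ?orbT // => v vg; apply: gw; rewrite inE vg orbT.
  move: yx; rewrite yw eqxx andbT => /orP[/eqP wx|/eqP->]; rewrite ?eqxx //.
  by have := gw x (mem_head _ _); rewrite -wx eqxx.
split.
- by move=> a; rewrite inE => /predU1P[->|/SE].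
- split=> /=; last first.
    move=> v; rewrite inE mem_cat => /predU1P[->|/So ->] //.
    by rewrite mem_head orbT.
  rewrite uS andbT; apply/negP => /So; exact/negP.
- split; first by rewrite sz'.
  move=> v /sub.
  rewrite inE reachE => /predU1P[->|vf]; first by rewrite eqxx fS ?orbT.
  by rewrite (negbTE (fw _ vf)) fS.
- move=> a; rewrite inE reachE => /predU1P[->|aS] /=.
    by rewrite (negbTE uw) fS.
  by have ra := tails _ aS; rewrite (negbTE (nreach _ ra)).
move=> a; rewrite inE => /predU1P[->|aS] /=.
  rewrite (eq_count (a2 := pred1 w)) // => y /=; rewrite reachE.
  have out z : reaches S w z = (z == w).
    apply/idP/eqP => [|->]; last exact: connect0.
    move: z; apply: connect_right_ind => // x y' _ ->.
    by rewrite (negbTE (no_out y')).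
  by rewrite !out eqxx; case: eqVneq.
apply: leq_trans (caps _ aS); rewrite leq_add2r.
have a2w : a.2 != w.
  apply: contraNneq wo => <-; apply: So; exact: map_f.
elim: (f) (f') fx fw {uf sf fS caps sM wf' le sub sz'} => [|x g IH] [|y g'] //= /andP[yx gx] gw.
apply: leq_add; last by apply: IH => // v vg; apply: gw; rewrite inE vg orbT.
rewrite reachE (negbTE a2w) /=; have xw := gw x (mem_head _ _).
case/orP: yx => [/eqP->|/andP[/eqP -> /eqP ->]]; first by rewrite (negbTE xw).
by rewrite eqxx.
Qed.

Lemma sound_fold o1 o2 L : uniq (o1 ++ o2) -> {in L, forall e, sound o1 e} ->
  {in foldl step L o2, forall e, sound (o1 ++ o2) e}.
Proof.
elim: o2 o1 L => [|w o2 IH] o1 L; first by rewrite cats0.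
rewrite -cat1s catA => uo soundL; apply: IH => //.
apply: sound_step => //; move: uo; rewrite -catA cat_uniq => /and3P[_ /hasPn no _].
by apply: no; rewrite mem_head.
Qed.

Lemma finals_sound f S :
  (f, S) \in finals fst snd (cap I) (@len_lec I) m r T E ->
  exists A, skeleton I M A [set a in S] /\ abs_len S = total_len I [set a in S].
Proof.
rewrite /finals mem_filter => /andP[/allP /= compl].
have [[uo _] _] := topoP wf dag; move: uo; rewrite -[topo _ _ _ _]/([::] ++ _).
move=> /sound_fold fold_sound /fold_sound; case.
  move=> e; rewrite inE => /eqP->; split=> //.
  split; first by rewrite size_map.
  by move=> v /mapP[_ _ ->]; apply: connect0.
move=> SE [uS _] [sf fS] tails caps.
have uf : uniq f.
  apply: count_mem_uniq => v; have [vf|vf] := boolP (v \in f).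
    have /andP[le _] := compl v vf; apply/eqP; rewrite eqn_leq le /=.
    by rewrite -has_count has_pred1.
  by apply/eqP; rewrite -leqn0 leqNgt -has_count has_pred1.
have heads_in (a b : V * V) : a \in S -> b \in S -> a.2 = b.2 -> a = b.
  elim: (S) uS => //= c s IH /andP[cs /IH{}IH]; rewrite !inE.
  case/predU1P=> [->|aS] /predU1P[->|bS] //; last exact: IH.
    by move=> cb; rewrite cb map_f in cs.
  by move=> ac; rewrite -ac map_f in cs.
exists [set v in f]; split; last first.
  by apply: abs_len_total_len => //; apply: map_uniq uS.
have cardf : #|[set v in f]| = M by rewrite cardsE (card_uniqP uf).
have tree : tree_away_from r [set a in S].
  split=> [v|a|a b]; rewrite ?inE.
  - case/or3P => [/eqP->|/imsetP[a]|/imsetP[a]]; first exact: connect0.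
      by rewrite inE => aS ->; apply: tails.
    move=> aS ->; apply: (@connect_trans _ _ a.1).
      by apply: tails; move: aS; rewrite inE.
    by apply: arc_connect; move: aS; case: (a).
  - by move/SE => aE; apply: contraTneq aE => a2; case: a a2 => u _ /= ->; apply: no_arc_to_root.
  - by move=> aS bS; apply: heads_in.
split=> //.
- by apply/subsetP => a; rewrite inE => /SE.
- apply/subsetP => v; rewrite [v \in [set _ in _]]inE => vf; rewrite inE.
  have /andP[_] := compl v vf; rewrite mem_enum => -> /=.
  by apply: connect_tree_vertices; apply: fS.
move=> a; rewrite inE => aS; rewrite -slackE; apply: leq_trans (caps _ aS).
rewrite leq_add2r -size_filter -(card_uniqP (filter_uniq _ uf)).
apply: subset_leq_card; apply/subsetP => v; rewrite !inE mem_filter => /andP[h ->].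
by rewrite andbT.
Qed.


(** The root is added because the tokens stand there before anything is scanned. *)
Lemma prefix_closed o1 o2 x y : topological (o1 ++ o2) ->
  connect (arc_rel (arcs I)) y x -> x \in r :: o1 -> y \in r :: o1.
Proof.
move=> [_ ord]; move: x; apply: connect_right_ind => // u v _ IH uv.
rewrite inE => /predU1P[vr|vo1].
  by move: uv; rewrite vr (negbTE (no_arc_to_root wf dag u)).
have [p1 [p2 oE]] : exists p1 p2, o1 = p1 ++ v :: p2.
  by case/splitPr: vo1 => p1 p2; exists p1, p2.
have up1 : u \in p1 by apply: (ord p1 v (p2 ++ o2)); rewrite // oE -catA.
by apply: IH; rewrite oE inE mem_cat up1 orbT.
Qed.

Section Completeness.
Variables (A : {set V}) (Ss : {set V * V}).
Hypothesis skel : skeleton I M A Ss.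
Let al := enum A.
Notation conn := (connect (arc_rel Ss)).

(** The last vertex among the root and [o] on the path of [Ss] to [t]: where the token bound for [t]
    should stand once [o] has been scanned. *)
Definition frontier o (x t : V) :=
  [&& x \in r :: o, conn x t & [forall v, (v \in r :: o) && conn v t ==> conn v x]].

Definition covered (L : seq (seq V * seq (V * V))) o := exists e, [/\ e \in L,
  all2 (frontier o) e.1 al &
  (abs_len e.2 <= \sum_(a in Ss | a.2 \in o) len I a)%R].

Lemma Ss_len_ge0 a : a \in Ss -> (0 <= len I a)%R.
Proof.
case: skel => SE _ _ _ _ /(subsetP SE); case: wf => _ _ _ len_ge0 _; exact: len_ge0.
Qed.

(** If an element of [A] lies below [w] in [Ss], all tokens bound for such elements stand on the
    parent of [w] and jump together; otherwise the old entry still fits. *)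
Lemma covered_step o1 w o2 L : topological (o1 ++ w :: o2) ->
  covered L o1 -> covered (step L w) (o1 ++ [:: w]).
Proof.
have [SE tree AS AM capS] := skel.
move=> top [[f S] [eL fr le]]; have [uo ord] := top; rewrite /= in fr le.
have subE x y : conn x y -> connect (arc_rel (arcs I)) x y by apply: connect_subset.
have asym x y : conn x y -> conn y x -> x = y.
  by move=> /subE xy /subE yx; apply: connect_antisym dag xy yx.
have wo1 : w \notin o1.
  by move: uo; rewrite cat_uniq => /and3P[_ /hasPn no _]; apply: no; rewrite mem_head.
have step_le e : dominated (@len_lec I) L e \/
    e \in candidates fst snd (cap I) m E slack L w ->
    exists2 e', e' \in step L w & e'.1 = e.1 /\ (abs_len e'.2 <= abs_len e.2)%R.
  move=> h; have := dominated_insert_fold (@len_lec_refl I) (@len_lec_trans I)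
    (@len_lec_total I) h.
  by [].
have memo v : (v \in r :: (o1 ++ [:: w])) = (v \in r :: o1) || (v == w).
  by rewrite !inE mem_cat inE orbA.
(* The root occurs in the scanned order too, but no token has to jump to it; hence the test
   [w != r]. *)
have [/hasP[t0 t0A /andP[wr wt0]]|/hasPn none] :=
    boolP (has (fun t => (w != r) && conn w t) al); last first.
  have [|e' e'L [e1 e2]] := step_le (f, S).
    by left; exists (f, S) => //; split=> //; apply: len_lec_refl.
  exists e'; split=> //.
    rewrite e1 /=; apply: all2_imp_in fr => t tA x /and3P[xo xt /forallP max].
    rewrite /frontier memo xo xt /=; apply/forallP => v; apply/implyP => /andP[].
    rewrite memo => /orP[vo|/eqP->] vt; first by apply: (implyP (max v)); rewrite vo vt.
    have := none t tA; rewrite vt andbT negbK => /eqP wr.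
    by have := max r; rewrite mem_head -wr vt.
  apply: le_trans e2 (le_trans le _).
  (* [Ss] may have an arc into [w] with no element of [A] below it; the entry saves its nonnegative
     length. *)
  rewrite (bigID (fun a : V * V => a.2 \in o1) (fun a => (a \in Ss) && (a.2 \in o1 ++ _))) /=.
  rewrite [X in (_ <= X + _)%R](eq_bigl (fun a => (a \in Ss) && (a.2 \in o1))); last first.
    by move=> a; rewrite mem_cat -andbA; case: (a.2 \in o1); rewrite ?andbF //= ?orbT.
  rewrite lerDl; apply: sumr_ge0 => a /andP[/andP[aS _] _]; exact: Ss_len_ge0.
have wo : w \notin r :: o1 by rewrite inE negb_or wr.
have t0AV : t0 \in tree_vertices r Ss.
  by have := subsetP AS t0; rewrite -mem_enum t0A inE => /(_ isT)/andP[].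
have rt0 : conn r t0 by rewrite -tree_verticesE.
have rw : conn r w.
  have [//|wr'] := tree_ancestors_comparable tree rt0 wt0.
  have := no_arc_to_root wf dag; case/connect_last_arc: wr' => [->|]; first by rewrite connect0.
  by move=> [u /(subsetP SE) uE _] /(_ u); rewrite uE.
have [u uw ru] : exists2 u, (u, w) \in Ss & conn r u.
  by case/connect_last_arc: rw => [rw|//]; rewrite rw eqxx in wr.
have uo1 : u \in o1 by apply: ord (subsetP SE _ uw).
have [_ _ inSs] := tree.
pose g (p : V * V) := if conn w p.2 then w else p.1.
(* Both [x] and [w] are ancestors of [t], hence comparable. As [x] is in the scanned part and [w] is
   not, [x] lies above [w], so above or at [u]; being the last scanned ancestor, it is [u]. *)
have fr_u t x : frontier o1 x t -> conn w t -> x = u.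
  move=> /and3P[xo xt /forallP max] wt.
  have xw : x != w by apply: contraNneq wo => <-.
  have xu : conn x u.
    have [|wx] := tree_ancestors_comparable tree xt wt; last first.
      by case/negP: wo; apply: prefix_closed top (subE _ _ wx) xo.
    case/connect_last_arc => [eqxw|[u' u'w xu']]; first by rewrite eqxw eqxx in xw.
    by have [<-] := inSs _ _ u'w uw erefl.
  apply: asym xu _; apply: (implyP (max u)).
  by rewrite inE uo1 orbT; apply: connect_trans (arc_connect uw) wt.
have fr' : all2 (frontier (o1 ++ [:: w])) (map g (zip f al)) al.
  apply: all2_map_zip_l fr => t tA x frx; rewrite /g /=.
  have := frx; case/and3P=> xo xt /forallP max; rewrite /frontier memo.
  case: (boolP (conn w t)) => wt.
    rewrite eqxx orbT wt; apply/forallP => v; apply/implyP => /andP[].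
    rewrite memo => /orP[vo|/eqP->] vt; last exact: connect0.
    apply: connect_trans (arc_connect uw); rewrite -(fr_u _ _ frx wt).
    by apply: (implyP (max v)); rewrite vo.
  rewrite xo xt; apply/forallP => v; apply/implyP => /andP[].
  rewrite memo => /orP[vo|/eqP->] vt; last by rewrite vt in wt.
  by apply: (implyP (max v)); rewrite vo.
have alM : size al = M by rewrite -AM cardE.
have fM : size f <= m.
  by move: fr; rewrite all2E alM => /andP[/eqP-> _]; rewrite /M size_take_min geq_minl.
have f'ex : map g (zip f al) \in expand m u w f.
  rewrite mem_expand //; apply: all2_map_zip_r fr => t tA x frx; rewrite /g /=.
  by case: ifP => [/(fr_u _ _ frx)->|_]; rewrite ?eqxx ?orbT.
(* This turns the test made by the algorithm into the skeleton condition at the arc [(u, w)]. *)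
have cnt : count_mem w (map g (zip f al)) = #|subtree Ss w :&: A|.
  have -> : #|subtree Ss w :&: A| = count (conn w) al.
    rewrite cardE /al /enum_mem size_filter count_filter.
    by apply: eq_count => z; rewrite /= !inE.
  elim: (f) (al) fr => [|x s IH] [|t l] //= /andP[frx /IH ->].
  congr (_ + _); rewrite /g /=; case: ifP => _; first by rewrite eqxx.
  by case/and3P: frx => xo _ _; case: eqP => // xw; rewrite xw (negbTE wo) in xo.
have w_in : w \in map g (zip f al).
  rewrite -has_pred1 has_count cnt; apply/card_gt0P; exists t0.
  by rewrite !inE wt0 -mem_enum.
have [|e' e'L [e1 e2]] := step_le (map g (zip f al), (u, w) :: S).
  right; apply/mem_candidates; exists (f, S), (u, w); split=> //=.
    by rewrite memE (subsetP SE).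
  by rewrite w_in cnt slackE; apply: capS uw.
exists e'; split; rewrite ?e1 //=; apply: le_trans e2 _.
rewrite /abs_len big_cons ger0_norm ?Ss_len_ge0 //.
rewrite (bigD1 (u, w)) /=; last by rewrite uw mem_cat mem_head orbT.
rewrite lerD2l; apply: le_trans le _.
rewrite (bigID (fun a : V * V => a.2 \in o1)
  (fun a => (a \in Ss) && (a.2 \in o1 ++ [:: w]) && (a != (u, w)))) /=.
rewrite [X in (_ <= X + _)%R](eq_bigl (fun a => (a \in Ss) && (a.2 \in o1))); last first.
  move=> a; rewrite mem_cat; case: (boolP (a.2 \in o1)) => a2; rewrite ?andbF //= !andbT.
  suff -> : a != (u, w) by rewrite andbT.
  by apply: contraNneq wo1 => aE; move: a2; rewrite aE.
by rewrite lerDl; apply: sumr_ge0 => a /andP[/andP[/andP[aS _] _] _]; exact: Ss_len_ge0.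
Qed.

Lemma covered_fold o1 o2 L : topological (o1 ++ o2) -> covered L o1 ->
  covered (foldl step L o2) (o1 ++ o2).
Proof.
elim: o2 o1 L => [|w o2 IH] o1 L topo cov; first by rewrite cats0.
rewrite -cat1s catA; apply: IH; first by rewrite -catA.
exact: covered_step topo cov.
Qed.

Lemma finals_complete : exists e,
  e \in finals fst snd (cap I) (@len_lec I) m r T E /\
  (abs_len e.2 <= total_len I Ss)%R.
Proof.
have [SE tree AS AM capS] := skel; have [top all_in] := topoP wf dag.
have start : covered [:: (map (fun=> r) (take m T), [::])] [::].
  exists (map (fun=> r) (take m T), [::]); split; first exact: mem_head.
    have alM : size al = size (take m T) by rewrite -/M -AM cardE.
    have rt : {in al, forall t, frontier [::] r t}.
      move=> t; rewrite mem_enum => /(subsetP AS); rewrite inE => /andP[_ tV].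
      rewrite /frontier mem_head -tree_verticesE // tV /=.
      by apply/forallP => v; rewrite inE; apply/implyP => /andP[/eqP-> _]; apply: connect0.
    move: alM rt; rewrite /=; elim: (al) (take m T) => [|t l IH] [|x s] //= [sE] rt.
    rewrite rt ?mem_head //=; apply: IH => // y yl; apply: rt.
    by rewrite inE yl orbT.
  by rewrite /abs_len big_nil; apply: sumr_ge0 => a /andP[aS _]; exact: Ss_len_ge0.
have := covered_fold (o1 := [::]) top start; case=> -[f S] [eL fr le].
exists (f, S).
(* All vertices are scanned, so the last scanned ancestor of a destination is that destination. *)
have fE : f = al.
  rewrite /= in fr; elim: (f) (al) fr => [|x s IH] [|t l] //= /andP[/and3P[_ xt /forallP max] /IH ->].
  congr (_ :: _); apply: connect_antisym dag (connect_subset SE xt) (connect_subset SE _).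
  by apply: (implyP (max t)); rewrite inE all_in connect0 orbT.
split; last first.
  apply: le_trans le _; rewrite /total_len le_eqVlt; apply/orP; left; apply/eqP.
  by apply: eq_bigl => a; rewrite all_in andbT.
rewrite /finals mem_filter /dp eL andbT /complete fE; apply/allP => v vA.
rewrite count_uniq_mem ?enum_uniq // leq_b1 /=.
by move: vA; rewrite !mem_enum => /(subsetP AS); rewrite inE => /andP[].
Qed.

End Completeness.

End Correctness.

(** * Encoded and abstract instances *)

Definition raw_vertices n (a : 'I_n * 'I_n) : nat * nat := (val a.1, val a.2).

Definition raw_of_arc (I : instance) (a : 'I_(order I) * 'I_(order I)) : raw_arc :=
  (raw_vertices a, (`|numq (len I a)|%N, `|denq (len I a)|%N, cap I a)).

Definition raw_of (I : instance) : raw_instance :=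
  (order I, (val (root I), (map val (enum (terminals I)),
    map (@raw_of_arc I) (enum (arcs I))))).

Lemma enc_seq_map A B (e : B -> tree) (f : A -> B) s :
  enc_seq e (map f s) = enc_seq (fun a => e (f a)) s.
Proof. by elim: s => //= a s ->. Qed.

(** Makes decoding unnecessary: a program timed on raw instances already runs on the encoding of
    [I]. *)
Lemma enc_raw_of I : enc (raw_of I) = enc_instance I.
Proof.
rewrite /raw_of /enc_instance /enc /enc_pair_inst /enc /enc_pair_inst /enc /=.
by rewrite /enc_pair_inst /enc /= /enc_seq_inst !enc_seq_map.
Qed.

Lemma enc_arcs_map n (s : seq ('I_n * 'I_n)) :
  enc (map (@raw_vertices n) s) = enc_arcs s.
Proof. by rewrite /enc /enc_seq_inst enc_seq_map. Qed.

Lemma raw_of_uncap I : raw_of (uncapacitated I) = raw_uncap (raw_of I).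
Proof.
rewrite /raw_of /raw_uncap /=; congr (_, (_, (_, _))).
rewrite -map_comp; apply: eq_map => a /=.
by rewrite /raw_of_arc /= ffunE size_map cardE.
Qed.

Lemma raw_costE I (S : seq ('I_(order I) * 'I_(order I))) :
  let c := raw_cost (map (@raw_of_arc I) S) in
  0 < c.2 /\ (c.1%:R / c.2%:R)%R = abs_len S.
Proof.
rewrite /raw_cost; elim/last_ind: S => [|S a [IH1 IH2]].
  by rewrite /abs_len big_nil mul0r.
rewrite map_rcons foldl_rcons; move: (foldl _ _ _) IH1 IH2 => -[p q] /= q0 pq.
have d0 : 0 < `|denq (len I a)|%N by rewrite absz_gt0 denq_neq0.
split; first by rewrite muln_gt0 q0.
have lenE : (`|len I a| = `|numq (len I a)|%N%:R / `|denq (len I a)|%N%:R :> rat)%R.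
  rewrite -[in LHS](divq_num_den (len I a)) normrM normfV !pmulrn !abszE.
  by rewrite -!intr_norm.
rewrite /abs_len -cats1 big_cat big_seq1 /= -/(abs_len S) -pq lenE.
rewrite natrD !natrM addf_div ?pnatr_eq0 -?lt0n //.
Qed.

Lemma raw_lecE I (S S' : seq ('I_(order I) * 'I_(order I))) :
  raw_lec (map (@raw_of_arc I) S) (map (@raw_of_arc I) S') = len_lec S S'.
Proof.
rewrite /raw_lec /len_lec; have [q0 <-] := raw_costE S; have [q0' <-] := raw_costE S'.
by rewrite ler_pdivrMr ?ltr0n // mulrAC ler_pdivlMr ?ltr0n // -!natrM ler_nat.
Qed.

Definition ord_finals m (I : instance) :=
  finals fst snd (cap I) (@len_lec I) m (root I) (enum (terminals I)) (enum (arcs I)).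

Lemma raw_finalsE m I : raw_finals m (raw_of I) =
  map (fun e => (map val e.1, map (@raw_of_arc I) e.2)) (ord_finals m I).
Proof.
by apply: finals_natural => //; [apply: val_inj | apply: raw_lecE].
Qed.

Lemma raw_mergeE m I s : raw_merge m (raw_of I, map (@raw_vertices _) s) =
  let S := cheapest (@len_lec I) (ord_finals m I) in
  map (@raw_vertices _) (S ++ filter (fun a => a.2 \notin map snd S) s).
Proof.
rewrite /raw_merge /= raw_finalsE (cheapest_natural _ (@raw_lecE I)) map_cat.
rewrite -!map_comp; congr (_ ++ _); rewrite filter_map; congr map.
apply: eq_filter => a /=; rewrite -(mem_map val_inj); congr (_ \notin _).
by rewrite -map_comp.
Qed.

Lemma set_graft (V : finType) (S s : seq (V * V)) :
  [set a in S ++ filter (fun a => a.2 \notin map snd S) s] =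
  graft [set a in S] [set a in s].
Proof.
apply/setP => a; rewrite !inE mem_cat mem_filter andbC; congr (_ || (_ && ~~ _)).
apply/mapP/imsetP => -[b bS ->]; first by exists b; rewrite ?inE.
by exists b; move: bS; rewrite ?inE.
Qed.

Lemma cmin_le I a : a \in arcs I -> cmin I <= cap I a.
Proof.
rewrite /cmin => aE; move: (\max_(_ in _) _) => top.
elim: (index_enum _) (mem_index_enum a) => // b s IH.
rewrite inE big_cons => /predU1P[<-|/IH le]; first by rewrite aE geq_minl.
by case: ifP => // _; rewrite geq_min le orbT.
Qed.

Lemma exists_optimal J : (exists S, feasible J S) -> exists S, optimal J S.
Proof.
case=> S0 f0.
have [d Pd] : exists d : {set {set 'I_(order J) * 'I_(order J)}},
    forall S, (S \in d) <-> feasible J S.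
  (* Feasibility is a proposition; it is made boolean classically, in order to minimise over the
     finitely many arc sets. *)
  exists [set S | boolp.asbool (feasible J S)] => S; rewrite inE.
  by split=> /boolp.asboolP.
have S0d : S0 \in d by apply/Pd.
case: (arg_minP (fun S => total_len J S) S0d) => S Sd minS.
by exists S; split; [apply/Pd | move=> S' /Pd/minS].
Qed.

(** * The feasibility test, the approximation algorithm and its ratio *)

Section Solution.
Variables (I : instance) (k : nat).
Hypothesis wf : well_formed I.
Hypothesis dag : is_dag I.
Hypothesis large : forall a, a \in arcs I -> #|terminals I| <= cap I a + k.

Let sizeM : size (take k.*2 (enum (terminals I))) = minn k.*2 #|terminals I|.
Proof. by rewrite size_take_min cardE. Qed.

Lemma finals_of_feasible S : feasible I S ->
  exists e, e \in ord_finals k.*2 I /\ (abs_len e.2 <= total_len I S)%R.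
Proof.
move=> /(feasible_skeleton large)[A]; rewrite -sizeM => skel.
have [e [eF le]] := finals_complete wf dag skel; exists e; split; [exact: eF|exact: le].
Qed.

Lemma graft_finals_feasible e (S' : {set 'I_(order I) * 'I_(order I)}) : e \in ord_finals k.*2 I ->
  S' \subset arcs I -> tree_away_from (root I) S' ->
  terminals I \subset tree_vertices (root I) S' ->
  feasible I (graft [set a in e.2] S') /\
  (total_len I (graft [set a in e.2] S') <= abs_len e.2 + total_len I S')%R.
Proof.
case: e => f S /(finals_sound wf dag)[A []]; rewrite sizeM => skel -> S'E tree TS'.
split; first exact: graft_feasible skel (large_cap large) S'E tree TS'.
by apply: total_len_graft => //; case: skel.
Qed.

Lemma raw_feasibleP : raw_feasible k.*2 (raw_of I) <-> exists S, feasible I S.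
Proof.
rewrite /raw_feasible raw_finalsE /nilp size_map -lt0n -has_predT; split.
  case/hasP => e eF _; have [S' [S'E tree TS']] := spanning_tree wf dag.
  by exists (graft [set a in e.2] S'); case: (graft_finals_feasible eF S'E tree TS').
by case=> S /finals_of_feasible[e [eF _]]; apply/hasP; exists e.
Qed.

End Solution.

Lemma polytime_of_ptime Y `{Enc Y} (f : raw_instance -> Y) (C : instance -> Prop)
    (ok : instance -> tree -> Prop) : ptime f ->
  (forall I, C I -> ok I (enc (f (raw_of I)))) -> exists A, polytime_on A C ok.
Proof.
move=> [p [tm [c [d tmP]] ev]] okP; exists p, c, d => I CI.
have [t evt tle] := ev (raw_of I); exists t, (enc (f (raw_of I))).
rewrite -enc_raw_of; split=> //; last exact: okP.
exact: leq_trans tle (tmP _).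
Qed.

Lemma large_cmin_cap (R : realType) (kappa : R) : exists k : nat,
  forall I, large_cmin kappa I ->
    forall a, a \in arcs I -> #|terminals I| <= cap I a + k.
Proof.
(* This [k] depends on [kappa] alone, so one program serves all instances. *)
exists (Num.bound `|kappa|%R) => I large a aE.
apply: leq_trans (_ : _ <= cmin I + Num.bound `|kappa|%R) _; last first.
  by rewrite leq_add2r cmin_le.
rewrite -(ler_nat R) natrD; move: large; rewrite /large_cmin lerBlDr => /le_trans; apply.
rewrite lerD2l; apply: ltW; apply: le_lt_trans (ler_norm _) _.
by rewrite archi_boundP.
Qed.

Lemma steiner_uncap I : well_formed I -> steiner_instance (uncapacitated I).
Proof.
move=> [conn [T2 rT] reach len_ge0 cap_gt0]; split; last by move=> a _; rewrite ffunE.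
by split=> // a _; rewrite ffunE; apply: ltnW.
Qed.

Lemma feasible_uncap I S : feasible (uncapacitated I) S <->
  [/\ S \subset arcs I, tree_away_from (root I) S
    & terminals I \subset tree_vertices (root I) S].
Proof.
split=> [[SE tree TS _]|[SE tree TS]]; first by [].
by split=> // a _; rewrite ffunE subset_leq_card // subsetIr.
Qed.

Local Open Scope ring_scope.

Theorem theorem7p2 (R : realType) (kappa : R) (kappa_ge0 : 0 <= kappa) :
  solvable_in_polytime
    (fun I => [/\ cap_instance I, is_dag I & large_cmin kappa I])
  /\
  (forall rho : instance -> R,
     (forall I, steiner_instance I -> is_dag I -> 1 <= rho I) ->
     approximable_within (fun I => steiner_instance I /\ is_dag I) rho ->
     approximable_within
       (fun I => [/\ well_formed I, is_dag I & large_cmin kappa I])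
       (fun I => 1 + rho (uncapacitated I))).
Proof.
have [k largek] := large_cmin_cap kappa; split.
  apply: (polytime_of_ptime (pt_feasible k.*2)) => I [[wf _] dag /largek large].
  exists (raw_feasible k.*2 (raw_of I)) => //.
  exact: raw_feasibleP wf dag large.
move=> rho rho_ge1 [A [c [d AP]]].
have [pU [tU ptU evU]] := pt_uncap.
have [pM [tM [c' [d' ptM]] evM]] := pt_merge k.*2.
pose (tA := fun x => (c * sz (raw_uncap x) ^ d)%N).
pose (B := fun x => (6 * sz x + tU x + tA x + 1 + c' * (sz x + tA x + 1) ^ d')%N).
have ptA : pbounded tA by rewrite /tA; have szU := ptime_size pt_uncap; pb.
have [c2 [d2 BP]] : pbounded B by rewrite /B; pb.
exists (PSeq (PPair PId (PSeq pU A)) pM), c2, d2 => I [wf dag /largek large].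
have SI := steiner_uncap wf.
have [t [y [evA tle yok]]] := AP _ (conj SI dag).
(* Without capacities the instance is feasible even if [I] is not, so [A] always outputs a list of
   arcs; the time bound of the merging step relies on this for every [I]. *)
have [S0 [S0E tree0 TS0]] := spanning_tree wf dag.
have [|s [yE sF sopt]] := yok; first by exists S0; apply/feasible_uncap.
have [sE treeS TS] : [/\ [set a in s] \subset arcs I,
    tree_away_from (root I) [set a in s]
  & terminals I \subset tree_vertices (root I) [set a in s]] by apply/feasible_uncap.
have [tu evu tule] := evU (raw_of I).
rewrite -enc_raw_of raw_of_uncap in evA tle.
have [tm evm tmle] := evM (raw_of I, map (@raw_vertices _) s).
eexists; exists (enc (raw_merge k.*2 (raw_of I, map (@raw_vertices _) s))).
split.
- rewrite -enc_raw_of; apply: EvSeq evm; apply: EvPair (EvId _) _.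
  by apply: EvSeq evu _; rewrite enc_arcs_map -yE; exact: evA.
- rewrite -enc_raw_of; apply: leq_trans (BP (raw_of I)).
  have ys : (sz (map (@raw_vertices (order I)) s) <= t)%N.
    by rewrite /sz enc_arcs_map -yE; apply: eval_size evA.
  have tmle' : (tm <= c' * (sz (raw_of I) + tA (raw_of I) + 1) ^ d')%N.
    apply: leq_trans tmle (leq_trans (ptM _) _).
    rewrite leq_mul2l; apply/orP; right.
    have : (sz (raw_of I, map (@raw_vertices (order I)) s) <=
            sz (raw_of I) + tA (raw_of I) + 1)%N.
      rewrite sz_pair [_.1]/= [_.2]/= addn1 ltnS leq_add2l.
      exact: leq_trans ys tle.
    by case: (d') => // ? ?; rewrite leq_exp2r.
  rewrite /B; move: tmle' tle tule; rewrite -!/(sz _) -/(tA (raw_of I)).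
  by move: (c' * _)%N => X; lia.
move=> [S1 fS1].
have finals0 : ord_finals k.*2 I != [::].
  by have [e [eF _]] := finals_of_feasible wf dag large fS1; case: ord_finals eF.
have [e eF [SE' emin]] := cheapestP (@len_lec_refl I) (@len_lec_trans I) (@len_lec_total I) finals0.
exists (e.2 ++ filter (fun a => a.2 \notin map snd e.2) s).
rewrite raw_mergeE /= SE' enc_arcs_map set_graft.
have [fG lenG] := graft_finals_feasible wf dag large eF sE treeS TS.
split=> // Sopt [fopt minopt].
have [e' [e'F e'le]] := finals_of_feasible wf dag large fopt.
have fuopt : feasible (uncapacitated I) Sopt.
  by apply/feasible_uncap; case: fopt.
(* The guarantee of [A] refers to an optimal Steiner tree [Su], which is no longer than [Sopt],
   itself a Steiner tree. *)
have [Su [fSu minSu]] : exists Su, optimal (uncapacitated I) Su.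
  by apply: exists_optimal; exists Sopt.
have rho1 := rho_ge1 _ SI dag.
apply: le_trans (_ : ratr (abs_len e.2 + total_len I [set a in s]) <= _).
  by rewrite ler_rat.
rewrite rmorphD mulrDl mul1r; apply: lerD.
  (* [Sopt] is a skeleton for some set of terminals, so the cheapest entry costs no more. *)
  by rewrite ler_rat; apply: le_trans (emin _ e'F) e'le.
apply: le_trans (sopt Su (conj fSu minSu)) _.
by rewrite ler_wpM2l ?ler_rat ?minSu // (le_trans ler01).
Qed.
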